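(* Let $\phi_1,\dots,\phi_n:\mathbb{R}^m\to\mathbb{R}$ be convex, differentiable with $(1/\gamma)$-Lipschitz gradients ($\gamma>0$), let $g:\mathbb{R}^d\to\mathbb{R}$ be $1$-strongly convex, $\lambda>0$, and let $A_1,\dots,A_n\in\mathbb{R}^{d\times m}$ be nonzero. Assume that at each iteration of the algorithm Quartz (described in the context) only one dual variable is updated, chosen uniformly at random (i.e. $\mathbb{P}(\hat S=\{i\})=1/n$ for all $i\in[n]$), and that $v_i=\lambda_{\max}(A_i^\top A_i)$ for all $i\in[n]$. If $0<\epsilon\le P(w^0)-D(\alpha^0)$ and the integer $T$ satisfies $$T\ge\left(n+\frac{\max_i\lambda_{\max}(A_i^\top A_i)}{\lambda\gamma}\right)\log\left(\frac{P(w^0)-D(\alpha^0)}{\epsilon}\right),$$ then $\mathbb{E}[P(w^T)-D(\alpha^T)]\le\epsilon$.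
   Context: $[n]=\{1,\dots,n\}$; $\|\cdot\|$ is the Euclidean norm. $g$ is $1$-strongly convex means $g(w)\ge g(w')+\langle s,w-w'\rangle+\tfrac12\|w-w'\|^2$ for all $w,w'$ and every subgradient $s$ of $g$ at $w'$. $\xi^*(u)=\sup_s\{\langle s,u\rangle-\xi(s)\}$ is the convex (Fenchel) conjugate (possibly $+\infty$ for $\phi_i^*$; $g^*$ is finite and $1$-smooth). The primal and dual objectives are $$P(w)=\frac1n\sum_{i=1}^n\phi_i(A_i^\top w)+\lambda g(w),\quad w\in\mathbb{R}^d,$$ $$D(\alpha)=-\lambda g^*\Big(\frac1{\lambda n}\sum_{i=1}^nA_i\alpha_i\Big)-\frac1n\sum_{i=1}^n\phi_i^*(-\alpha_i),\quad \alpha=(\alpha_1,\dots,\alpha_n)\in(\mathbb{R}^m)^n.$$ Algorithm Quartz (with random set $\hat S\subseteq[n]$, $p_i=\mathbb{P}(i\in\hat S)>0$, and positive vector $v\in\mathbb{R}^n$): choose $\alpha^0\in(\mathbb{R}^m)^n$, $w^0\in\mathbb{R}^d$ (deterministic); set $\theta=\min_i\frac{p_i\lambda\gamma n}{v_i+\lambda\gamma n}$ and $\bar\alpha^0=\frac1{\lambda n}\sum_iA_i\alpha_i^0$. For $t=1,2,\dots$: (1) $w^t=(1-\theta)w^{t-1}+\theta\nabla g^*(\bar\alpha^{t-1})$; (2) draw a random set $S_t\subseteq[n]$ with the distribution of $\hat S$, independently of all previous draws; (3) for $i\notin S_t$ put $\alpha_i^t=\alpha_i^{t-1}$; for $i\in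 S_t$ put $\alpha_i^t=\alpha_i^{t-1}+\Delta\alpha_i^t$, where $\Delta\alpha_i^t$ is given by one of the two options (the result holds for either option): Option I: $\Delta\alpha_i^t=\arg\max_{\Delta\in\mathbb{R}^m}\big[-\phi_i^*(-(\alpha_i^{t-1}+\Delta))-\nabla g^*(\bar\alpha^{t-1})^\top A_i\Delta-\frac{v_i\|\Delta\|^2}{2\lambda n}\big]$; Option II: $\Delta\alpha_i^t=-\theta p_i^{-1}\alpha_i^{t-1}-\theta p_i^{-1}\nabla\phi_i(A_i^\top w^t)$; (4) $\bar\alpha^t=\bar\alpha^{t-1}+\frac1{\lambda n}\sum_{i\in S_t}A_i\Delta\alpha_i^t$ (so $\bar\alpha^t=\frac1{\lambda n}\sum_iA_i\alpha_i^t$). *)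

(* Defs.v *)
From HB Require Import structures.
From mathcomp Require Import all_boot all_order all_algebra.
From mathcomp Require Import all_classical all_reals all_analysis.

Set Implicit Arguments.
Unset Strict Implicit.
Unset Printing Implicit Defensive.

Import Order.TTheory GRing.Theory Num.Theory.
Import numFieldNormedType.Exports.

Local Open Scope classical_set_scope.
Local Open Scope ring_scope.

(* The library norm `|x| on matrices is the sup norm, so the Euclidean norm has
   to be introduced; both norms induce the same topology and differential. *)
Definition dot {R : realType} {k : nat} (x y : 'cV[R]_k) : R :=
  \sum_(j < k) x j 0 * y j 0.

Definition enorm {R : realType} {k : nat} (x : 'cV[R]_k) : R :=
  Num.sqrt (dot x x).

Definition grad {R : realType} {k : nat} (f : 'cV[R]_k -> R) (x : 'cV[R]_k) :
    'cV[R]_k :=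
  \col_(j < k) 'D_(delta_mx j 0) f x.

Definition lipschitz_grad {R : realType} {k : nat} (L : R)
    (f : 'cV[R]_k -> R) : Prop :=
  forall x y, enorm (grad f x - grad f y) <= L * enorm (x - y).

Definition subgradient {R : realType} {k : nat} (f : 'cV[R]_k -> R)
    (x s : 'cV[R]_k) : Prop :=
  forall y, f x + dot s (y - x) <= f y.

(* Convexity is required explicitly: the subgradient inequality alone would hold
   vacuously for a function without any subgradient. *)
Definition strongly_convex {R : realType} {k : nat} (mu : R)
    (f : 'cV[R]_k -> R) : Prop :=
  convex_function [set: convex_lmodType 'cV[R]_k] f /\
  forall w w' s, subgradient f w' s ->
    f w' + dot s (w - w') + mu / 2 * enorm (w - w') ^+ 2 <= f w.

Definition conjugate {R : realType} {k : nat} (f : 'cV[R]_k -> R)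
    (u : 'cV[R]_k) : \bar R :=
  ereal_sup (range (fun s : 'cV[R]_k => (dot s u - f s)%:E)).

(* For real symmetric M the set of real eigenvalues is finite and, if k > 0,
   nonempty, so that the supremum is the largest eigenvalue. *)
Definition lambda_max {R : realType} {k : nat} (M : 'M[R]_k) : R :=
  sup [set a | eigenvalue M a].

Section objectives.
Context {R : realType} {n d m : nat}.
Variables (phi : 'I_n -> 'cV[R]_m -> R) (g : 'cV[R]_d -> R) (lambda : R).
Variable A : 'I_n -> 'M[R]_(d, m).

Definition primal (w : 'cV[R]_d) : R :=
  n%:R^-1 * (\sum_(i < n) phi i ((A i)^T *m w)) + lambda * g w.

(* Values in [-oo, +oo[ : g^* is finite and phi_i^* never takes the value -oo. *)
Definition dual (alpha : 'I_n -> 'cV[R]_m) : \bar R :=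
  (- (lambda%:E *
       conjugate g ((lambda * n%:R)^-1 *: \sum_(i < n) A i *m alpha i))
   - n%:R^-1%:E * \sum_(i < n) conjugate (phi i) (- alpha i))%E.

End objectives.

HB.instance Definition _ (I : finType) := isPointed.Build {set I} finset.set0.

HB.instance Definition _ (I : finType) :=
  @isMeasurable.Build default_measure_display {set I}
    discrete_measurable discrete_measurable0
    discrete_measurableC discrete_measurableU.

Definition mutually_independent {dT dU : measure_display}
    {T : measurableType dT} {U : measurableType dU} {R : realType}
    (P : probability T R) {I : eqType} (X : I -> T -> U) : Prop :=
  forall (J : seq I) (B : I -> set U),
    uniq J -> (forall i, measurable (B i)) ->
    P (\bigcap_(i in [set` J]) (X i @^-1` B i)) =
    (\prod_(i <- J) P (X i @^-1` B i))%E.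

Definition inclusion_prob {dT : measure_display} {T : measurableType dT}
    {R : realType} (P : probability T R) {n : nat} (Shat : T -> {set 'I_n})
    (i : 'I_n) : R :=
  fine (P [set om | i \in Shat om]).

Section quartz.
Context {R : realType} {n d m : nat}.
Variables (phi : 'I_n -> 'cV[R]_m -> R) (g : 'cV[R]_d -> R) (lambda gamma : R).
Variables (A : 'I_n -> 'M[R]_(d, m)) (p v : 'I_n -> R).

(* The infimum of a finite set, nonempty for n > 0, hence a minimum. *)
Definition theta : R :=
  inf (range (fun i : 'I_n =>
    p i * lambda * gamma * n%:R / (v i + lambda * gamma * n%:R))).

(* The conjugate of a strongly convex real function is real valued. *)
Definition grad_conj (u : 'cV[R]_d) : 'cV[R]_d :=
  grad (fun x => fine (conjugate g x)) u.

Inductive quartz_option := OptionI | OptionII.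

Definition optionI_objective (i : 'I_n) (a : 'cV[R]_m) (abar : 'cV[R]_d)
    (Delta : 'cV[R]_m) : \bar R :=
  (- conjugate (phi i) (- (a + Delta)%R)
   - (dot (grad_conj abar) (A i *m Delta))%:E
   - (v i * enorm Delta ^+ 2 / (2 * lambda * n%:R))%:E)%E.

(* a, abar are the values at time t-1 and w is the value at time t. *)
Definition quartz_update (o : quartz_option) (i : 'I_n) (a : 'cV[R]_m)
    (abar w : 'cV[R]_d) (Delta : 'cV[R]_m) : Prop :=
  match o with
  | OptionI => forall Delta' : 'cV[R]_m,
      (optionI_objective i a abar Delta' <= optionI_objective i a abar Delta)%E
  | OptionII => Delta =
      - (theta * (p i)^-1) *: a
      - (theta * (p i)^-1) *: grad (phi i) ((A i)^T *m w)
  end.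

(* One trajectory of the algorithm for a given sequence of drawn sets
   S_t = draw t, t >= 1; draw 0 and dalpha 0 are not used. *)
Record quartz_run (o : quartz_option) (w0 : 'cV[R]_d)
    (alpha0 : 'I_n -> 'cV[R]_m) (draw : nat -> {set 'I_n})
    (w abar : nat -> 'cV[R]_d) (alpha dalpha : nat -> 'I_n -> 'cV[R]_m) :
    Prop := QuartzRun {
  quartz_w0 : w 0%N = w0 ;
  quartz_alpha0 : alpha 0%N = alpha0 ;
  quartz_abar0 : abar 0%N = (lambda * n%:R)^-1 *: \sum_(i < n) A i *m alpha0 i ;
  quartz_w : forall t,
    w t.+1 = (1 - theta) *: w t + theta *: grad_conj (abar t) ;
  quartz_notin : forall t i, i \notin draw t.+1 -> alpha t.+1 i = alpha t i ;
  quartz_in : forall t i, i \in draw t.+1 ->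
    alpha t.+1 i = alpha t i + dalpha t.+1 i ;
  quartz_dalpha : forall t i, i \in draw t.+1 ->
    quartz_update o i (alpha t i) (abar t) (w t.+1) (dalpha t.+1 i) ;
  quartz_abar : forall t,
    abar t.+1 =
    abar t + (lambda * n%:R)^-1 *: \sum_(i in draw t.+1) A i *m dalpha t.+1 i
}.

End quartz.

(* Main.v *)
(* Writing [x_i = A_i^T w^t], [u_i = - grad phi_i x_i] and [z = grad g^* abar],
   both options increase the dual objective at least as much as the step
   [theta / p_i (u_i - alpha_i)]. Strong convexity of [phi_i^*], smoothness of
   [g^*] and the choice of [theta] make the quadratic terms cancel, and the
   Fenchel equalities [phi_i^*(- u_i) = <x_i, - u_i> - phi_i x_i] and
   [g^* abar + g z = <z, abar>] turn the bound into
   [E_i gap(t+1) <= (1 - theta) gap(t)] for every state at time [t]. The state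
   at time [t] is determined by the first [t] draws, so that conditioning
   amounts to summing over finite draw prefixes. Finally
   [1 / theta = n + max_i v_i / (lambda gamma)] and
   [(1 - theta)^T <= exp (- theta T)]. *)

Require Import Defs.
From HB Require Import structures.
From mathcomp Require Import all_boot all_order all_algebra.
From mathcomp Require Import all_classical all_reals all_analysis.
From mathcomp Require Import measurable_realfun ring lra.

Import Order.TTheory GRing.Theory Num.Theory.
Import numFieldNormedType.Exports.

Local Open Scope classical_set_scope.
Local Open Scope ring_scope.

(** * The Euclidean inner product *)

(** The quadratic term in the strong convexity of [g] is available only at subgradients, so a
    subgradient of [g] and the differentiability of [g^*] have to be derived first. One subgradient
    makes [g - <u, .>] coercive for every [u], hence its minimum is attained at some [z], and this
    [z] is the gradient of [g^*] at [u]. On the other side [phi_i^*] may be infinite and is never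
    differentiated: only an interpolation inequality between its values is used, and finiteness is
    handed on from one dual point to the next.

    The run is given outcome by outcome, without any measurability. Uniqueness of the Option I
    maximizer makes the state a function of the draws, and this yields both adaptedness and
    measurability of the gap. Outcomes with a draw that is not a singleton form a null set, so the
    contraction is claimed for singleton prefixes only. Weak duality keeps the gap nonnegative,
    which lets extended real integrals be split over prefixes freely. *)

Section dot.
Context {R : realType} {k : nat}.
Implicit Types (x y z : 'cV[R]_k) (a : R).

Lemma dotC x y : dot x y = dot y x.
Proof. by apply: eq_bigr => j _; rewrite mulrC. Qed.

Lemma dotDl x y z : dot (x + y) z = dot x z + dot y z.
Proof. by rewrite -big_split; apply: eq_bigr => j _; rewrite mxE mulrDl. Qed.

Lemma dotZl a x y : dot (a *: x) y = a * dot x y.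
Proof. by rewrite mulr_sumr; apply: eq_bigr => j _; rewrite mxE mulrA. Qed.

Lemma dotNl x y : dot (- x) y = - dot x y.
Proof. by rewrite -scaleN1r dotZl mulN1r. Qed.

Lemma dotDr x y z : dot x (y + z) = dot x y + dot x z.
Proof. by rewrite dotC dotDl !(dotC x). Qed.

Lemma dotZr a x y : dot x (a *: y) = a * dot x y.
Proof. by rewrite dotC dotZl dotC. Qed.

Lemma dotNr x y : dot x (- y) = - dot x y.
Proof. by rewrite dotC dotNl dotC. Qed.

Lemma dot0r x : dot x 0 = 0.
Proof. by rewrite -(scale0r 0) dotZr mul0r. Qed.

Lemma dot0l x : dot 0 x = 0.
Proof. by rewrite dotC dot0r. Qed.

Lemma dot_sumr (I : Type) (s : seq I) (P : pred I) (F : I -> 'cV[R]_k) x :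
  dot x (\sum_(i <- s | P i) F i) = \sum_(i <- s | P i) dot x (F i).
Proof.
by elim/big_rec2: _ => [|i ? ? _ <-]; rewrite ?dot0r ?dotDr.
Qed.

Lemma dot_ge0 x : 0 <= dot x x.
Proof. by apply: sumr_ge0 => j _; rewrite -expr2 sqr_ge0. Qed.

Lemma dot_delta x (j : 'I_k) : dot x (delta_mx j 0) = x j 0.
Proof.
rewrite /dot (bigD1 j)//= big1 => [|i /negPf ij]; rewrite mxE ?ij ?eqxx/=.
  by rewrite mulr1 addr0.
by rewrite mulr0.
Qed.

Lemma dot_ext x y : (forall z, dot x z = dot y z) -> x = y.
Proof. by move=> xy; apply/colP => j; rewrite -!dot_delta. Qed.

Lemma sqr_coord_le x (j : 'I_k) : x j 0 ^+ 2 <= dot x x.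
Proof.
rewrite /dot (bigD1 j)//= -expr2 lerDl.
by apply: sumr_ge0 => i _; rewrite -expr2 sqr_ge0.
Qed.

Lemma dot_eq0 x : dot x x = 0 -> x = 0.
Proof.
move=> x0; apply/colP => j; rewrite mxE; apply/eqP.
by rewrite -sqrf_eq0 eq_le sqr_ge0 andbT -x0 sqr_coord_le.
Qed.

Lemma enorm_sqr x : enorm x ^+ 2 = dot x x.
Proof. by rewrite sqr_sqrtr ?dot_ge0. Qed.

Lemma enorm_ge0 x : 0 <= enorm x.
Proof. exact: sqrtr_ge0. Qed.

Lemma cauchy_schwarz x y : dot x y <= enorm x * enorm y.
Proof.
have [->|x0] := eqVneq x 0; first by rewrite dot0l mulr_ge0 ?enorm_ge0.
have xx : 0 < dot x x.
  by rewrite lt_neqAle dot_ge0 andbT eq_sym; apply: contra_neq x0 => /dot_eq0.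
rewrite (le_trans (ler_norm _))// -sqrtrM ?dot_ge0// -sqrtr_sqr ler_sqrt.
  have := dot_ge0 (dot x y *: x - dot x x *: y).
  rewrite !(dotDl, dotDr, dotNl, dotNr, dotZl, dotZr) (dotC y x) => h.
  have : 0 <= dot x x * (dot x x * dot y y - dot x y ^+ 2) by nra.
  by rewrite pmulr_rge0// subr_ge0.
by rewrite mulr_ge0 ?dot_ge0.
Qed.

Lemma continuous_dot x : continuous (dot x).
Proof.
apply: (@continuous_big R^o _ _ _ xpredT (@add_continuous R^o) 'cV[R]_k _
  (fun j (y : 'cV[R]_k) => x j 0 * y j 0)) => j _ y.
by apply: continuousM; [exact: cst_continuous|exact: coord_continuous].
Qed.

Lemma continuous_dot_sqr : continuous (fun x : 'cV[R]_k => dot x x).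
Proof.
apply: (@continuous_big R^o _ _ _ xpredT (@add_continuous R^o) 'cV[R]_k _
  (fun j (y : 'cV[R]_k) => y j 0 * y j 0)) => j _ y.
by apply: continuousM; exact: coord_continuous.
Qed.

End dot.

Lemma dot_mulmx {R : realType} {k l : nat} (M : 'M[R]_(k, l)) x y :
  dot (M *m x) y = dot x (M^T *m y).
Proof.
have dotE (j : nat) (u v : 'cV[R]_j) : dot u v = (u^T *m v) 0 0.
  by rewrite mxE; apply: eq_bigr => i _; rewrite mxE.
by rewrite !dotE trmx_mul mulmxA.
Qed.

(** [bounded_closed_compact] concerns row vectors, hence the transport by transposition;
    coordinatewise the sup norm is bounded by the Euclidean one. *)
Lemma closed_bounded_compact_cV {R : realType} {k : nat} (S : set 'cV[R]_k)
    (r : R) :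
  closed S -> (forall x, S x -> dot x x <= r) -> compact S.
Proof.
move=> clS bS.
have trc : continuous (@trmx R 1 k).
  move=> x P [B nB BP]; exists (fun i j => B j i) => [i j|y yB].
    by have := nB j i; rewrite mxE.
  by apply: BP => i j; rewrite mxE.
have -> : S = (@trmx R 1 k) @` ((@trmx R 1 k) @^-1` S).
  apply/seteqP; split => [x Sx|_ [x Sx <-]]//.
  by exists x^T; rewrite /= trmxK.
apply: continuous_compact; first exact: continuous_subspaceT.
apply: bounded_closed_compact; last first.
  by apply: closed_comp => // ? _; exact: trc.
exists (Num.sqrt r); split; first exact: num_real.
move=> M rM x Sx; apply: le_trans (ltW rM).
rewrite [leLHS]/Num.norm/= mx_normrE; apply/bigmax_leP; split => [|[i j] _ /=].
  exact: sqrtr_ge0.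
rewrite ord1 -sqrtr_sqr ler_sqrt; last exact: le_trans (dot_ge0 _) (bS _ Sx).
by apply: le_trans (bS _ Sx); have := sqr_coord_le x^T j; rewrite mxE.
Qed.

(** * Convex functions and conjugates *)

Section convex.
Context {R : realType} {k : nat}.
Implicit Types (f : 'cV[R]_k -> R) (x y h u : 'cV[R]_k).

Lemma convex_functionW f : convex_function [set: convex_lmodType 'cV[R]_k] f ->
  forall t x y, 0 <= t -> t <= 1 ->
  f (t *: x + (1 - t) *: y) <= t * f x + (1 - t) * f y.
Proof.
move=> cf t x y t0 t1.
by have := cf (Itv01 t0 t1) x y (in_setT _) (in_setT _).
Qed.

Lemma coord_le_mx_norm x (j : 'I_k) : `|x j 0| <= `|x|.
Proof.
rewrite [leRHS]/Num.norm/= mx_normrE; apply/bigmax_geP; right.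
by exists (j, 0).
Qed.

Lemma mx_norm_leP x (r : R) :
  0 <= r -> (forall j, `|x j 0| <= r) -> `|x| <= r.
Proof.
move=> r0 xr; rewrite [leLHS]/Num.norm/= mx_normrE.
by apply/bigmax_leP; split => // -[i j] _ /=; rewrite ord1.
Qed.

Lemma convex_axis_bound f x e :
  convex_function [set: convex_lmodType 'cV[R]_k] f ->
  exists2 M, 0 <= M & forall s, `|s| <= 1 -> f (x + s *: e) - f x <= M * `|s|.
Proof.
move=> /convex_functionW cf.
exists (`|f (x + e) - f x| + `|f (x - e) - f x|); first by rewrite addr_ge0.
have step e' s : 0 <= s <= 1 -> f (x + s *: e') - f x <= s * (f (x + e') - f x).
  move=> /andP[s0 s1]; have := cf s (x + e') x s0 s1.
  have -> : s *: (x + e') + (1 - s) *: x = x + s *: e'.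
    by rewrite scalerDr scalerBl scale1r addrC addrA subrK addrC.
  lra.
have le1 := ler_norm (f (x + e) - f x).
have le2 := ler_norm (f (x - e) - f x).
have ge1 := normr_ge0 (f (x + e) - f x).
have ge2 := normr_ge0 (f (x - e) - f x).
move=> s; have [s0|s0] := leP 0 s.
  rewrite ger0_norm// => s1.
  have /step h : 0 <= s <= 1 by rewrite s0.
  by apply: le_trans (h e) _; nra.
rewrite ltr0_norm// => s1.
have /step h : 0 <= - s <= 1 by rewrite s1 oppr_ge0 ltW.
have := h (- e); rewrite scalerN scaleNr opprK => /le_trans; apply.
nra.
Qed.

(** Induction on the number [l] of leading coordinates in which [h] may be nonzero: [x + h] is the
    midpoint of [x + 2 h'] and a point on an axis through [x]. Doubling the increments and halving
    the values cancel, so the constants simply add up. *)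
Lemma convex_locally_bounded f x :
  convex_function [set: convex_lmodType 'cV[R]_k] f ->
  exists2 M, 0 <= M &
    exists2 r, 0 < r & forall h, `|h| <= r -> f (x + h) - f x <= M * `|h|.
Proof.
move=> cf; have cf' := convex_functionW f cf.
suff /(_ k (leqnn k))[M M0 [r r0 H]] : forall l, (l <= k)%N ->
    exists2 M, 0 <= M & exists2 r, 0 < r & forall h,
    (forall j : 'I_k, (l <= j)%N -> h j 0 = 0) -> `|h| <= r ->
    f (x + h) - f x <= M * `|h|.
  exists M => //; exists r => // h; apply: H => j.
  by rewrite leqNgt ltn_ord.
elim=> [_|l IH lk].
  exists 0 => //; exists 1 => // h h0 _.
  have -> : h = 0 by apply/colP => j; rewrite h0 ?mxE.
  by rewrite addr0 subrr mul0r.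
have [M M0 [r r0 H]] := IH (ltnW lk).
pose i := Ordinal lk.
have [N N0 HN] := convex_axis_bound f x (delta_mx i 0) cf.
exists (M + N); first exact: addr_ge0.
exists (Num.min (r / 2) (1 / 2)); first by rewrite lt_min !divr_gt0.
move=> h h0; rewrite le_min => /andP[hr h1].
pose h' := h - h i 0 *: delta_mx i 0.
have h'j j : h' j 0 = if j == i then 0 else h j 0.
  rewrite !mxE; have [->|_] := eqVneq; first by rewrite mulr1 subrr.
  by rewrite mulr0 subr0.
have h'h : `|h'| <= `|h|.
  apply: mx_norm_leP => // j; rewrite h'j.
  by case: ifP => _; rewrite ?normr0// coord_le_mx_norm.
have n2 y : `|2 *: y| = 2 * `|y| by rewrite normrZ ger0_norm.
have hi := coord_le_mx_norm h i.
have a1 : f (x + 2 *: h') - f x <= M * (2 * `|h|).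
  apply: le_trans (H (2 *: h') _ _) _.
  - move=> j lj; rewrite mxE h'j; case: eqP => [_|ji]; first by rewrite mulr0.
    rewrite h0 ?mulr0// ltn_neqAle lj andbT; apply/eqP => lj'.
    by apply: ji; apply: val_inj.
  - by rewrite n2; lra.
  - by rewrite n2 ler_wpM2l//; lra.
have a2 : f (x + (2 * h i 0) *: delta_mx i 0) - f x <= N * (2 * `|h|).
  apply: le_trans (HN _ _) _; rewrite normrM (ger0_norm (ler0n _ 2)); first lra.
  by rewrite ler_wpM2l//; lra.
have h2 : 0 <= (2^-1 : R) by [].
have h3 : (2^-1 : R) <= 1 by lra.
have := cf' _ (x + 2 *: h') (x + (2 * h i 0) *: delta_mx i 0) h2 h3.
have -> : 2^-1 *: (x + 2 *: h') + (1 - 2^-1) *: (x + (2 * h i 0) *: delta_mx i 0)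
   = x + h.
  apply/colP => j; rewrite /h' !mxE; lra.
lra.
Qed.

Lemma convex_continuous f :
  convex_function [set: convex_lmodType 'cV[R]_k] f -> continuous f.
Proof.
move=> cf x; have cf' := convex_functionW f cf.
have [M M0 [r r0 H]] := convex_locally_bounded f x cf.
have FF : ProperFilter (nbhs x) by exact: nbhs_pfilter.
apply/cvgrPdist_lt => e e0.
(* Lower bound by reflection: [x] is the midpoint of [x + h] and [x - h], and the upper bound
   applies at [- h]. *)
have hN h : `|h| <= r -> f x - f (x + h) <= M * `|h|.
  rewrite -(normrN h) => hr.
  have h2 : 0 <= (2^-1 : R) by [].
  have h3 : (2^-1 : R) <= 1 by lra.
  have := cf' _ (x + h) (x - h) h2 h3.
  have -> : 2^-1 *: (x + h) + (1 - 2^-1) *: (x - h) = x.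
    by apply/colP => j; rewrite !mxE; lra.
  by have := H (- h) hr; lra.
near=> y.
have yr : `|y - x| <= r.
  rewrite distrC; near: y; apply: cvgr_dist_le => //; exact: cvg_id.
have yM : M * `|y - x| < e.
  have : `|y - x| < e / (M + 1).
    rewrite distrC; near: y; apply: cvgr_dist_lt; [exact: cvg_id|].
    by rewrite divr_gt0// ltr_wpDl.
  by rewrite ltr_pdivlMr ?ltr_wpDl//; have := normr_ge0 (y - x); lra.
have := hN _ yr; have := H _ yr; rewrite !(addrC x) !subrK => a b.
by rewrite ltr_norml; apply/andP; split; lra.
Unshelve. all: by end_near. Qed.

End convex.

(** * Subgradients and attained conjugates *)

Section subgradient.
Context {R : realType} {k : nat}.
Implicit Types (f : 'cV[R]_k -> R) (x y h u z : 'cV[R]_k).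

(* For large [K], [f + K |.|^2] attains its minimum over the unit ball in the
   interior. *)
Lemma exists_subgradient f :
  convex_function [set: convex_lmodType 'cV[R]_k] f ->
  exists x s, subgradient f x s.
Proof.
move=> cf; have cf' := convex_functionW f cf.
pose B := [set x : 'cV[R]_k | dot x x <= 1].
have B0 : B 0 by rewrite /B/= dot0l.
have clB : closed B.
  apply: (@closed_comp _ _ (fun x : 'cV[R]_k => dot x x) [set r : R | r <= 1]).
    by move=> x _; exact: continuous_dot_sqr.
  exact: closed_le.
have cB : compact B by apply: (closed_bounded_compact_cV B 1 clB).
have ctf := convex_continuous f cf.
have [|c _ fc] := compact_EVT_min _ cB (continuous_subspaceT ctf).
  by exists 0.
pose K := f 0 - f c + 1.
have K0 : 0 < K by have := fc 0 (mem_set B0); rewrite /K; lra.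
have ctF : continuous (fun x : 'cV[R]_k => f x + K * dot x x).
  move=> x; apply: (@continuousD _ R^o _ f (fun x => K * dot x x)); first exact: ctf.
  by apply: continuousM; [exact: cst_continuous|exact: continuous_dot_sqr].
have [|x0 Bx0 Fx0] := compact_EVT_min _ cB (continuous_subspaceT ctF).
  by exists 0.
move/set_mem: Bx0 => Bx0.
have x01 : dot x0 x0 < 1.
  rewrite lt_neqAle (Bx0 : dot x0 x0 <= 1) andbT; apply/eqP => x01.
  have := Fx0 0 (mem_set B0); rewrite dot0l x01.
  have := fc x0 (mem_set Bx0); rewrite /K; lra.
(* Stationarity of the minimizer: the slope is minus the gradient of [K |.|^2] at [x0]. *)
exists x0, (- (2 * K) *: x0) => y; rewrite dotZl.
have [v yE] : exists v, y = x0 + v by exists (y - x0); rewrite addrC subrK.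
have -> : y - x0 = v by rewrite yE addrAC subrr add0r.
rewrite leNgt; apply/negP.
set D := f x0 + _ => Dgt.
pose C := 2 * `|dot x0 v| + dot v v + 1.
have vv := dot_ge0 v; have xv0 := normr_ge0 (dot x0 v).
have C0 : 0 < C by rewrite /C; lra.
(* Three bounds: [t] is a convexity weight, [x0 + t v] stays in the ball, and [K t^2 |v|^2] is at
   most half of the linear gain [t (D - f y)]. *)
pose t := Num.min (Num.min 1 ((1 - dot x0 x0) / C)) ((D - f y) / (2 * K * C)).
have t0 : 0 < t by rewrite !lt_min ltr01 !divr_gt0// ?mulr_gt0//; lra.
have : t <= t by [].
rewrite {2}/t !le_min !ler_pdivlMr ?mulr_gt0// => /andP[/andP[t1 t2] t3].
have Bt : B (x0 + t *: v).
  rewrite /B/= !(dotDl, dotDr, dotZl, dotZr) (dotC v x0).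
  have : t * dot x0 v <= t * `|dot x0 v| by rewrite ler_pM2l// ler_norm.
  have : t * (t * dot v v) <= t * dot v v.
    by rewrite ler_pM2l// ler_piMl.
  move: t2; rewrite /C; nra.
have := Fx0 _ (mem_set Bt).
have := cf' t y x0 (ltW t0) t1.
have -> : t *: y + (1 - t) *: x0 = x0 + t *: v.
  rewrite yE; apply/colP => j; rewrite !mxE; lra.
rewrite !(dotDl, dotDr, dotZl, dotZr) (dotC v x0) => h1 h2.
have h3 : 0 <= t * (f y - D + K * (t * dot v v)) by rewrite /D; nra.
rewrite pmulr_rge0// in h3.
have : K * (t * dot v v) <= K * (t * C).
  by rewrite !ler_pM2l// /C; lra.
nra.
Qed.

(** A subgradient at one point [x1] suffices: with strong convexity it makes [f - <u, .>] coercive,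
    so a sublevel set is compact and contains a minimizer, where [u] is a subgradient. *)
Lemma strongly_convex_attained f u :
  strongly_convex 1 f -> exists z, subgradient f z u.
Proof.
move=> [cf scf]; have [x1 [s1 sub1]] := exists_subgradient f cf.
pose F w := f w - dot u w.
have ctF : continuous F.
  move=> x; apply: (@continuousB _ R^o _ f (dot u)); first exact: convex_continuous.
  exact: continuous_dot.
pose S := [set w | F w <= F x1].
have clS : closed S.
  apply: (@closed_comp _ _ F [set r : R | r <= F x1]).
    by move=> x _; exact: ctF.
  exact: closed_le.
pose a := s1 - u.
(* With [y = w - x1], the inequality [|y|^2 / 2 + <a, y> <= 0] gives [|y|^2 <= 4 |a|^2]; then
   [|x1 + y|^2 <= 2 |x1|^2 + 2 |y|^2]. *)
have bS w : S w -> dot w w <= 8 * dot a a + 2 * dot x1 x1.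
  rewrite /S/= /F => Sw; have := scf w x1 s1 sub1; rewrite enorm_sqr.
  move: Sw; have [y ->] : exists y, w = x1 + y.
    by exists (w - x1); rewrite addrC subrK.
  have -> : x1 + y - x1 = y by rewrite addrAC subrr add0r.
  have := dot_ge0 (y + 2 *: a); have := dot_ge0 (x1 - y).
  rewrite /a !(dotDl, dotDr, dotNl, dotNr, dotZl, dotZr).
  rewrite (dotC y x1) (dotC y u) (dotC y s1) (dotC u s1).
  lra.
have [|z _ Fz] := compact_EVT_min _ (closed_bounded_compact_cV S _ clS bS)
  (continuous_subspaceT ctF).
  by exists x1; rewrite /S/=.
exists z => y; have {}Fz : F z <= F y.
  have [Sy|Sy] := leP (F y) (F x1); first by apply: Fz; apply: mem_set.
  apply: le_trans (ltW Sy); apply: Fz; exact: mem_set (lexx _).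
by move: Fz; rewrite /F dotDr dotNr; lra.
Qed.

Lemma conjugate_ge f u x : ((dot x u - f x)%:E <= conjugate f u)%E.
Proof. by apply: ereal_sup_ubound; exists x. Qed.

Lemma conjugate_le f u (c : \bar R) :
  (forall x, (dot x u - f x)%:E <= c)%E -> (conjugate f u <= c)%E.
Proof. by move=> h; apply: ge_ereal_sup => _ [x _ <-]. Qed.

Lemma conjugate_subgradient f z u :
  subgradient f z u -> conjugate f u = (dot z u - f z)%:E.
Proof.
move=> sub; apply/eqP; rewrite eq_le conjugate_ge andbT.
apply: conjugate_le => y; rewrite lee_fin.
by have := sub y; rewrite dotDr dotNr (dotC u) (dotC u); lra.
Qed.

End subgradient.

(** * Smoothness of the conjugate of a strongly convex function *)

Section strongly_convex_conjugate.
Context {R : realType} {k : nat} {f : 'cV[R]_k -> R}.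
Hypothesis scf : strongly_convex 1 f.
Implicit Types (x y h u z : 'cV[R]_k).

Lemma conjugate_fin u : (fine (conjugate f u))%:E = conjugate f u.
Proof.
have [z sub] := strongly_convex_attained f u scf.
by rewrite (conjugate_subgradient _ _ _ sub).
Qed.

(** On the left, [z] competes in the supremum at [u + h]. On the right, strong convexity at [z]
    bounds every competitor [y] after completing the square in [y - z - h]. *)
Lemma conjugate_smooth_at z u h : subgradient f z u ->
  fine (conjugate f u) + dot z h <= fine (conjugate f (u + h))
  <= fine (conjugate f u) + dot z h + 1 / 2 * dot h h.
Proof.
move=> sub; rewrite -!lee_fin !conjugate_fin.
rewrite (conjugate_subgradient _ _ _ sub)/=; apply/andP; split.
  by apply: le_trans (conjugate_ge _ _ z); rewrite lee_fin dotDr; lra.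
apply: conjugate_le => y; rewrite lee_fin dotDr.
have := scf.2 y z u sub; rewrite enorm_sqr.
have := dot_ge0 (y - z - h).
rewrite !(dotDl, dotDr, dotNl, dotNr, dotZl, dotZr).
rewrite (dotC z y) (dotC h y) (dotC h z) (dotC u z) (dotC u y).
lra.
Qed.

(** The preceding sandwich puts each difference quotient within [|t| / 2] of the coordinate of [z],
    so [grad_conj], defined through [fine] and a limit, has its intended value. *)
Lemma grad_conjE z u : subgradient f z u -> grad_conj f u = z.
Proof.
move=> sub; apply/colP => j; rewrite mxE.
apply/cvg_lim => //.
apply/cvgrPdist_lt => e e0; near=> t.
have t0 : t != 0 by near: t; exact: nbhs_dnbhs_neq.
have te : `|t| < e.
  near: t; apply: dnbhs0_lt => //.
have /andP[] := conjugate_smooth_at z u (t *: delta_mx j 0) sub.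
rewrite dotZl !dotZr !dot_delta mxE !eqxx mulr1.
set p := fine _; set q := fine _ => h1 h2.
rewrite distrC /= (addrC _ u) -/q.
have -> : t^-1 *: (q - p) - z j 0 = t^-1 * (q - p - t * z j 0).
  by rewrite mulrBr mulKf.
rewrite normrM normfV ltr_pdivrMl ?normr_gt0// ger0_norm; last lra.
have : `|t| * `|t| < `|t| * e by rewrite ltr_pM2l// normr_gt0.
rewrite -normrM ger0_norm -?expr2 ?sqr_ge0//; nra.
Unshelve. all: by end_near. Qed.

Lemma grad_conj_subgradient u : subgradient f (grad_conj f u) u.
Proof.
have [z sub] := strongly_convex_attained f u scf.
by rewrite (grad_conjE z).
Qed.

End strongly_convex_conjugate.

(** * Gradient inequalities for differentiable functions *)

Section gradient.
Context {R : realType} {k : nat} {f : 'cV[R]_k -> R}.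
Hypothesis df : forall x, differentiable f x.
Implicit Types (x y v a b : 'cV[R]_k).

Lemma derive_grad x v : 'D_v f x = dot (grad f x) v.
Proof.
have vE : v = \sum_(j < k) v j 0 *: delta_mx j 0.
  rewrite [LHS]matrix_sum_delta; apply: eq_bigr => j _.
  by rewrite big_ord1.
rewrite deriveE// {1}vE linear_sum; apply: eq_bigr => j _.
by rewrite linearZ mxE -deriveE//= mulrC.
Qed.

Lemma convex_grad_subgradient x :
  convex_function [set: convex_lmodType 'cV[R]_k] f -> subgradient f x (grad f x).
Proof.
move=> /convex_functionW cf y; rewrite -derive_grad.
have [v yE] : exists v, y = x + v by exists (y - x); rewrite addrC subrK.
have -> : y - x = v by rewrite yE addrAC subrr add0r.
(* If the slope exceeded [f y - f x], so would a difference quotient at a small [t], against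
   convexity. *)
rewrite leNgt; apply/negP => lt.
have /cvg_ex[l ql] : derivable f x v by exact: diff_derivable.
have lE : 'D_v f x = l by apply/cvg_lim.
move: ql => /cvgrPdist_lt/(_ ('D_v f x + f x - f y)).
rewrite subr_gt0 [_ + f x]addrC => /(_ lt)[/= e e0 He].
pose t := Num.min 1 (e / 2).
have t0 : 0 < t by rewrite lt_min ltr01 divr_gt0.
have : t <= t by [].
rewrite {2}/t le_min => /andP[t1 te].
have te' : t < e by lra.
have := He t; rewrite /= sub0r normrN gtr0_norm// => /(_ te' (lt0r_neq0 t0)).
rewrite -lE ltr_norml => /andP[_].
have := cf t y x (ltW t0) t1.
have -> : t *: y + (1 - t) *: x = t *: v + x.
  by rewrite yE; apply/colP => j; rewrite !mxE; lra.
move=> h1; have h2 : t^-1 * (f (t *: v + x) - f x) <= f y - f x.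
  by rewrite ler_pdivrMl//; lra.
rewrite /GRing.scale/=; lra.
Qed.

Lemma is_derive_line x v (t : R) :
  is_derive t 1 (fun t : R => f (x + t *: v)) (dot (grad f (x + t *: v)) v).
Proof.
have E : (fun h : R => h^-1 *: (f (x + (h *: 1 + t) *: v) - f (x + t *: v))) =
         (fun h : R => h^-1 *: (f (h *: v + (x + t *: v)) - f (x + t *: v))).
  apply/funext => h; congr (_ *: (f _ - _)).
  by rewrite scalerDl [h *: 1]mulr1 addrCA.
split; last by rewrite -derive_grad /derive/= E.
by rewrite /derivable E; exact: diff_derivable.
Qed.

(** [h] is [f] along the segment minus its quadratic model. Cauchy-Schwarz and the Lipschitz bound
    make its derivative nonpositive, and the mean value theorem concludes without integrating the
    gradient. *)
Lemma descent_lemma (L : R) x y : 0 <= L -> lipschitz_grad L f ->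
  f y <= f x + dot (grad f x) (y - x) + L / 2 * dot (y - x) (y - x).
Proof.
move=> L0 lf; have [v yE] : exists v, y = x + v.
  by exists (y - x); rewrite addrC subrK.
have -> : y - x = v by rewrite yE addrAC subrr add0r.
pose h t := f (x + t *: v) - (dot (grad f x) v * t + L / 2 * dot v v * t ^+ 2).
pose h' t := dot (grad f (x + t *: v)) v -
  (dot (grad f x) v + L * dot v v * t).
have dh (t : R) : is_derive t 1 h (h' t).
  have := is_derive_line x v t => d1.
  apply: is_deriveB; apply: is_derive_eq.
  rewrite /GRing.scale/= !mulr1. lra.
have [|c] := @MVT R h h' 0 1 ltr01 (fun t _ => dh t).
  by apply: derivable_within_continuous => t _; have [] := dh t.
rewrite in_itv/= => /andP[c0 c1].
have : h' c <= 0.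
  rewrite /h' opprD addrA -dotNl -dotDl subr_le0.
  apply: le_trans (cauchy_schwarz _ _) _.
  have -> : L * dot v v * c = L * enorm (c *: v) * enorm v.
    have -> : enorm (c *: v) = c * enorm v.
      rewrite /enorm dotZl dotZr mulrA sqrtrM ?mulr_ge0 ?ltW// -expr2.
      by rewrite sqrtr_sqr gtr0_norm.
    by rewrite -enorm_sqr; ring.
  rewrite ler_wpM2r ?enorm_ge0//.
  by have := lf (x + c *: v) x; rewrite addrAC subrr add0r.
rewrite /h subr0 mulr1 scale1r scale0r addr0 -yE expr0n expr1n /= !mulr0 !mulr1.
lra.
Qed.

End gradient.

(** * Strong convexity of the conjugate of a smooth function *)

Lemma conjugate_gtNy {R : realType} {k : nat} (f : 'cV[R]_k -> R) u :
  (-oo < conjugate f u)%E.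
Proof. by apply: lt_le_trans (conjugate_ge f u 0); exact: ltNyr. Qed.

(* Interpolating [y] between [y + s gamma (a - b)] and
   [y - (1 - s) gamma (a - b)] in the descent lemma dualizes smoothness. *)
Lemma conjugate_strongly_convex {R : realType} {k : nat} (f : 'cV[R]_k -> R)
    (gamma s A B : R) (a b : 'cV[R]_k) :
  (forall x, differentiable f x) -> 0 < gamma -> lipschitz_grad gamma^-1 f ->
  0 <= s -> s <= 1 ->
  (conjugate f a <= A%:E -> conjugate f b <= B%:E ->
  conjugate f ((1 - s) *: a + s *: b) <=
  ((1 - s) * A + s * B
    - gamma / 2 * (s * (1 - s)) * dot (a - b) (a - b))%:E)%E.
Proof.
move=> df gamma0 lf s0 s1 leA leB; apply: conjugate_le => y; rewrite lee_fin.
pose c := a - b.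
have gV0 : 0 <= gamma^-1 by rewrite invr_ge0 ltW.
have d1 := descent_lemma df gamma^-1 y (y + (s * gamma) *: c) gV0 lf.
have d2 := descent_lemma df gamma^-1 y (y - ((1 - s) * gamma) *: c) gV0 lf.
have a1 := le_trans (conjugate_ge f a (y + (s * gamma) *: c)) leA.
have b1 := le_trans (conjugate_ge f b (y - ((1 - s) * gamma) *: c)) leB.
rewrite !lee_fin in a1 b1.
have e1 (z : 'cV[R]_k) : y + z - y = z by rewrite addrAC subrr add0r.
rewrite !e1 in d1 d2.
have ca : dot c a = dot c c + dot c b by rewrite {3}/c dotDr dotNr subrK.
rewrite dotDl dotZl {}ca in a1; rewrite dotDl dotNl dotZl in b1.
rewrite dotZr dotZl dotZr in d1.
rewrite dotNr dotNl dotNr dotZr dotZl dotZr opprK in d2.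
rewrite (dotDr y) !dotZr -/c; set cc := dot c c in a1 b1 d1 d2 *.
have sq r : gamma^-1 / 2 * (r * gamma * (r * gamma * cc)) =
    gamma / 2 * (r ^+ 2 * cc).
  by field; rewrite gt_eqF.
rewrite (sq s) in d1; rewrite (sq (1 - s)) in d2.
rewrite -subr_ge0 in d1; rewrite -subr_ge0 in d2; rewrite -subr_ge0 in a1.
rewrite -subr_ge0 in b1; rewrite -subr_ge0.
have s1' : 0 <= 1 - s by rewrite subr_ge0.
(* The weights [1 - s] and [s] cancel the terms in [grad f y]. The pairings with [a] and [b] gain
   [gamma s (1 - s) |c|^2], of which the descent lemma takes back one half. *)
have h := addr_ge0 (addr_ge0 (mulr_ge0 s1' d1) (mulr_ge0 s1' a1))
  (addr_ge0 (mulr_ge0 s0 d2) (mulr_ge0 s0 b1)).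
by apply: le_trans h _; rewrite le_eqVlt; apply/orP; left; apply/eqP; field.
Qed.

(* The maximum of the Rayleigh quotient is an eigenvalue. *)
Lemma lambda_max_gram {R : realType} {d m : nat} (A : 'M[R]_(d, m)) x :
  (0 < m)%N -> dot (A *m x) (A *m x) <= lambda_max (A^T *m A) * dot x x.
Proof.
move=> m0; pose S := [set x : 'cV[R]_m | dot x x = 1].
have Q y z : dot (A *m y) (A *m z) = dot y (A^T *m A *m z).
  by rewrite dot_mulmx mulmxA.
have clS : closed S.
  apply: (@closed_comp _ _ (fun x : 'cV[R]_m => dot x x) [set r : R | r = 1]).
    by move=> ? _; exact: continuous_dot_sqr.
  exact: closed_eq.
have cS : compact S by apply: (closed_bounded_compact_cV S 1 clS) => y ->.
have ctA : continuous (fun x : 'cV[R]_m => dot (A *m x) (A *m x)).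
  have cA i : continuous (fun x : 'cV[R]_m => (A *m x) i 0).
    have -> : (fun x : 'cV[R]_m => (A *m x) i 0) = dot (row i A)^T.
      by apply/funext => y; rewrite mxE; apply: eq_bigr => j _; rewrite !mxE.
    exact: continuous_dot.
  apply: (@continuous_big R^o _ _ _ xpredT (@add_continuous R^o) 'cV[R]_m _
    (fun j (y : 'cV[R]_m) => (A *m y) j 0 * (A *m y) j 0)) => j _ y.
  by apply: continuousM; exact: cA.
have [|z /set_mem Sz zmax] := compact_EVT_max _ cS (continuous_subspaceT ctA).
  exists (delta_mx (Ordinal m0) 0).
  by rewrite /S/= dot_delta mxE !eqxx.
set mu := dot (A *m z) (A *m z) in zmax.
have le_mu y : dot (A *m y) (A *m y) <= mu * dot y y.
  have [->|y0] := eqVneq y 0; first by rewrite mulmx0 !dot0l mulr0.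
  have yy : 0 < dot y y.
    by rewrite lt_neqAle dot_ge0 andbT eq_sym; apply: contra_neq y0 => /dot_eq0.
  have /mem_set/zmax : S ((enorm y)^-1 *: y).
    by rewrite /S/= dotZl dotZr mulrA -expr2 exprVn enorm_sqr mulVf ?gt_eqF.
  rewrite -scalemxAr dotZl dotZr mulrA -expr2 exprVn enorm_sqr.
  by rewrite ler_pdivrMl// mulrC.
have eig : A^T *m A *m z = mu *: z.
  apply: dot_ext => y; apply/eqP; rewrite -subr_eq0 -dotNl -dotDl.
  set b := dot _ y; set q := mu * dot y y - dot (A *m y) (A *m y).
  have q0 : 0 <= q by rewrite subr_ge0.
  have H t : 0 <= t * (- (2 * b) + t * q).
    have := le_mu (z + t *: y); rewrite -subr_ge0; congr (_ <= _).
    rewrite mulmxDr -scalemxAr /b /q !(dotDl, dotDr, dotZl, dotZr, dotNl).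
    rewrite -/mu (Sz : dot z z = 1) (dotC (A *m y)) (dotC y z).
    rewrite [dot (A *m z) (A *m y)]dotC Q (dotC y).
    by ring.
  have [//|b0] := eqVneq b 0.
  have q1 : 0 < q + 1 by rewrite ltr_wpDl.
  (* A nonzero linear coefficient would make the quadratic negative at this [t]; the shift [q + 1]
     avoids dividing by zero. *)
  have := H (b / (q + 1)).
  have -> : b / (q + 1) * (- (2 * b) + b / (q + 1) * q) =
    - ((b / (q + 1)) ^+ 2 * (q + 2)) by field; rewrite gt_eqF.
  rewrite oppr_ge0 leNgt mulr_gt0//; last by rewrite ltr_wpDl.
  by rewrite exprn_even_gt0//= mulf_neq0// invr_neq0// gt_eqF.
have emu : eigenvalue (A^T *m A) mu.
  (* [eigenvalue] refers to row vectors, and [A^T A] is symmetric, hence [z^T]. *)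
  apply/eigenvalueP; exists z^T.
    by apply: trmx_inj; rewrite !trmx_mul linearZ/= !trmxK.
  apply/eqP => /(congr1 trmx); rewrite trmxK trmx0 => z0.
  by move: Sz; rewrite z0 /S/= dot0l => /eqP; rewrite eq_sym oner_eq0.
apply: le_trans (le_mu x) _; rewrite ler_wpM2r ?dot_ge0//.
(* Every eigenvalue is at most [mu] by the Rayleigh bound at its eigenvector, so [sup] is a genuine
   supremum and not its default value. *)
apply: ub_le_sup => //; exists mu => a /eigenvalueP[v va v0].
have {va} va : A^T *m A *m v^T = a *: v^T.
  by apply: trmx_inj; rewrite !trmx_mul trmxK linearZ/= !trmxK.
have vv : 0 < dot v^T v^T.
  rewrite lt_neqAle dot_ge0 andbT eq_sym; apply: contra_neq v0 => /dot_eq0.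
  by move=> /(congr1 trmx); rewrite trmxK trmx0.
by have := le_mu v^T; rewrite Q va dotZr ler_pM2r.
Qed.

(** * One iteration *)

Section one_step.
Context {R : realType} {n d m : nat}.
Variables (phi : 'I_n -> 'cV[R]_m -> R) (g : 'cV[R]_d -> R) (lambda gamma : R).
Variables (A : 'I_n -> 'M[R]_(d, m)) (p v : 'I_n -> R).
Hypothesis n_gt0 : (0 < n)%N.
Hypothesis gamma_gt0 : 0 < gamma.
Hypothesis lambda_gt0 : 0 < lambda.
Hypothesis phi_convex : forall i,
  convex_function [set: convex_lmodType 'cV[R]_m] (phi i).
Hypothesis phi_diff : forall i x, differentiable (phi i) x.
Hypothesis phi_lip : forall i, lipschitz_grad gamma^-1 (phi i).
Hypothesis scg : strongly_convex 1 g.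
Hypothesis pE : forall i, p i = n%:R^-1.
Hypothesis v_ge0 : forall i, 0 <= v i.
Hypothesis v_ge : forall i x, dot (A i *m x) (A i *m x) <= v i * dot x x.

Let N : R := n%:R.
Let th := theta lambda gamma p v.

Let N_gt0 : 0 < N. Proof. by rewrite ltr0n. Qed.

Let den_gt0 i : 0 < v i + lambda * gamma * N.
Proof. by rewrite ltr_wpDl// !mulr_gt0. Qed.

Let theta_term_gt0 i :
  0 < p i * lambda * gamma * N / (v i + lambda * gamma * N).
Proof. by rewrite divr_gt0// !mulr_gt0// pE invr_gt0. Qed.

Lemma theta_le i : th <= lambda * gamma / (v i + lambda * gamma * N).
Proof.
have -> : lambda * gamma / (v i + lambda * gamma * N) =
    p i * lambda * gamma * N / (v i + lambda * gamma * N).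
  by rewrite pE; field; rewrite !gt_eqF.
apply: ge_inf; last by exists i.
by exists 0 => _ [j _ <-]; exact: ltW.
Qed.

(** Source of the factor in the iteration bound: each term of the minimum equals
    [lambda gamma / (v_i + lambda gamma n)], which decreases in [v_i]. *)
Lemma theta_ge V : (forall i, v i <= V) ->
  (N + V / (lambda * gamma))^-1 <= th.
Proof.
move=> vV; have lg : 0 < lambda * gamma by rewrite mulr_gt0.
have V0 : 0 <= V := le_trans (v_ge0 (Ordinal n_gt0)) (vV _).
apply: lb_le_inf; first by exists (p (Ordinal n_gt0) * lambda * gamma * N /
  (v (Ordinal n_gt0) + lambda * gamma * N)), (Ordinal n_gt0).
move=> _ [i _ <-].
have -> : p i * lambda * gamma * N = lambda * gamma.
  by rewrite pE; field; rewrite gt_eqF.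
have -> : N + V / (lambda * gamma) = (V + lambda * gamma * N) / (lambda * gamma).
  by field; rewrite !gt_eqF.
rewrite invf_div ler_pM2l// lef_pV2 ?posrE ?lerD2r//.
by rewrite ltr_wpDl// mulr_gt0.
Qed.

Lemma theta_ge0 : 0 <= th.
Proof.
have h i : v i <= \sum_j v j by rewrite (bigD1 i)//= lerDl sumr_ge0.
apply: le_trans (theta_ge _ h).
rewrite invr_ge0 addr_ge0 ?(ltW N_gt0)// divr_ge0 ?sumr_ge0//.
by rewrite ltW// mulr_gt0.
Qed.

Lemma theta_le1 : th <= 1.
Proof.
apply: le_trans (theta_le (Ordinal n_gt0)) _.
rewrite ler_pdivrMr// mul1r.
have : lambda * gamma <= lambda * gamma * N.
  by rewrite ler_pMr ?mulr_gt0// ler1n.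
by have := v_ge0 (Ordinal n_gt0); lra.
Qed.

(** [Delta] is compared with the explicit step [D2] towards [- gx]. The term in [v_i |Delta|^2]
    stays on the left to pay later for the smoothness error of [g^*], and the real witness [C']
    keeps the dual point in the domain of the conjugate. *)
Lemma quartz_update_conjugate o i a abar w Delta C :
  quartz_update phi g lambda gamma A p v o i a abar w Delta ->
  conjugate (phi i) (- a) = C%:E ->
  let z := grad_conj g abar in
  let x := (A i)^T *m w in
  let gx := grad (phi i) x in
  exists2 C', conjugate (phi i) (- (a + Delta)) = C'%:E &
    C' + dot z (A i *m Delta) + v i * dot Delta Delta / (2 * lambda * N)
    <= C - th * N * (C + phi i x - dot x gx
                     + dot z (A i *m gx) + dot z (A i *m a)).
Proof.
move=> upd Ca z x gx; pose s := th * N.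
have lgN : 0 < lambda * gamma * N by rewrite !mulr_gt0.
(* The bound on [theta], rearranged: it lets the strong convexity gain absorb
   [v_i |D2|^2 / (2 lambda n)]. *)
have s_le : s * v i <= gamma * (1 - s) * (lambda * N).
  have := theta_le i; rewrite ler_pdivlMr// => h.
  have : N * (th * (v i + lambda * gamma * N)) <= N * (lambda * gamma).
    by rewrite ler_pM2l.
  by rewrite /s; lra.
have s0 : 0 <= s by rewrite mulr_ge0 ?theta_ge0// ltW.
have s1 : s <= 1.
  have : 0 <= gamma * (1 - s) * (lambda * N).
    by apply: le_trans s_le; rewrite mulr_ge0.
  by rewrite pmulr_lge0 ?mulr_gt0// pmulr_rge0// subr_ge0.
pose c := a + gx; pose D2 := - (s *: c).
pose B := dot x gx - phi i x.
have CB : conjugate (phi i) gx = B%:E.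
  exact/conjugate_subgradient/convex_grad_subgradient.
pose M := (1 - s) * C + s * B - gamma / 2 * (s * (1 - s)) * dot c c.
have CM : (conjugate (phi i) (- (a + D2)) <= M%:E)%E.
  have -> : - (a + D2) = (1 - s) *: (- a) + s *: gx.
    by apply/colP => j; rewrite /D2 /c !mxE; ring.
  rewrite /M; have -> : dot c c = dot (- a - gx) (- a - gx).
    by rewrite /c -opprD dotNl dotNr opprK.
  by apply: conjugate_strongly_convex => //; rewrite ?Ca ?CB.
have obj : (optionI_objective phi g lambda A v i a abar D2 <=
            optionI_objective phi g lambda A v i a abar Delta)%E.
  case: o upd => /= [|->]; first exact.
  have -> : - (th / p i) *: a - (th / p i) *: grad (phi i) ((A i)^T *m w) = D2.
    by rewrite pE invrK -/N -/s /D2 /c scalerDr scaleNr opprD.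
  by [].
have := conjugate_gtNy (phi i) (- (a + D2)).
have := conjugate_gtNy (phi i) (- (a + Delta)).
move: CM obj; rewrite /optionI_objective !enorm_sqr -/z.
case: (conjugate (phi i) (- (a + D2))) => // M2; rewrite lee_fin => M2M.
(* The value [+oo] is excluded since, by [obj], the objective at [Delta] is at least a real
   number. *)
case: (conjugate (phi i) (- (a + Delta))) => // C'.
rewrite -!EFinN -!EFinB lee_fin => obj _ _; exists C' => //.
have {obj} : C' + dot z (A i *m Delta) + v i * dot Delta Delta / (2 * lambda * N)
    <= M2 + dot z (A i *m D2) + v i * dot D2 D2 / (2 * lambda * N).
  by lra.
move=> /le_trans; apply.
have -> : dot z (A i *m D2) = - (s * (dot z (A i *m gx) + dot z (A i *m a))).
  rewrite /D2 mulmxN -scalemxAr dotNr dotZr /c mulmxDr dotDr.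
  by rewrite (addrC (dot z _)).
have -> : dot D2 D2 = s * (s * dot c c).
  by rewrite /D2 dotNl dotNr opprK dotZl dotZr.
have : v i * (s * (s * dot c c)) / (2 * lambda * N) <=
    gamma / 2 * (s * (1 - s)) * dot c c.
  rewrite ler_pdivrMr ?mulr_gt0//.
  have := ler_wpM2r (mulr_ge0 s0 (dot_ge0 c)) s_le.
  by congr (_ <= _); field.
by move: M2M; rewrite /M /B -/s; lra.
Qed.

Lemma dual_conjugate alpha (C : 'I_n -> R) :
  (forall i, conjugate (phi i) (- alpha i) = (C i)%:E) ->
  dual phi g lambda A alpha =
  (- (lambda * fine (conjugate g
      ((lambda * N)^-1 *: \sum_(i < n) A i *m alpha i)))
    - N^-1 * \sum_(i < n) C i)%:E.
Proof.
move=> CE; rewrite /dual -(conjugate_fin scg).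
by rewrite (eq_bigr _ (fun i _ => CE i)) sumEFin.
Qed.

(** Weak duality: the Fenchel-Young inequalities for [g] and all [phi_i] add up, and their pairings
    cancel by the form of [abar]. Infinite conjugates are allowed, so the gap is nonnegative at
    every outcome. *)
Lemma dual_le_primal alpha w :
  (dual phi g lambda A alpha <= (primal phi g lambda A w)%:E)%E.
Proof.
set abar := (lambda * N)^-1 *: \sum_(i < n) A i *m alpha i.
have le_g : dot w abar - g w <= fine (conjugate g abar).
  by rewrite -lee_fin conjugate_fin// conjugate_ge.
have le_phi : ((\sum_(i < n) (- dot ((A i)^T *m w) (alpha i)
    - phi i ((A i)^T *m w)))%:E <= \sum_(i < n) conjugate (phi i) (- alpha i))%E.
  rewrite -sumEFin; apply: lee_sum => i _; rewrite -dotNr.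
  exact: conjugate_ge.
rewrite /dual -/abar -(conjugate_fin scg abar).
have : ((- (N^-1 * \sum_(i < n) (- dot ((A i)^T *m w) (alpha i)
    - phi i ((A i)^T *m w))))%:E >=
    - (N^-1%:E * \sum_(i < n) conjugate (phi i) (- alpha i)))%E.
  by rewrite EFinN leeN2 EFinM lee_pmul2l// ?lte_fin ?invr_gt0.
move=> /(leeD2l (- (lambda%:E * (fine (conjugate g abar))%:E)))/le_trans; apply.
rewrite -EFinM -EFinN -EFinD lee_fin /primal big_split/= !sumrN.
have : N^-1 * \sum_(i < n) dot ((A i)^T *m w) (alpha i) = lambda * dot w abar.
  rewrite /abar dotZr dot_sumr mulrA (_ : lambda * _ = N^-1); last first.
    by field; rewrite !gt_eqF.
  by congr (_ * _); apply: eq_bigr => i _; rewrite dot_mulmx trmxK.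
move: le_g; rewrite -(ler_pM2l lambda_gt0) -/N; lra.
Qed.

(** Only one conjugate and one term of [abar] change. The smoothness error
    [|A_i Delta|^2 / (2 lambda n^2)] of [g^*] is covered by the quadratic term kept in the bound on
    the update. *)
Lemma quartz_coordinate_step o i alpha alpha' abar w w' Delta (C : 'I_n -> R) :
  let z := grad_conj g abar in
  abar = (lambda * N)^-1 *: \sum_(j < n) A j *m alpha j ->
  w' = (1 - th) *: w + th *: z ->
  (forall j, conjugate (phi j) (- alpha j) = (C j)%:E) ->
  quartz_update phi g lambda gamma A p v o i (alpha i) abar w' Delta ->
  alpha' i = alpha i + Delta -> (forall j, j != i -> alpha' j = alpha j) ->
  exists2 C', forall j, conjugate (phi j) (- alpha' j) = (C' j)%:E &
  (- dual phi g lambda A alpha' <= - dual phi g lambda A alpha +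
   (- th * (C i + dot z (A i *m alpha i)) - phi i ((A i)^T *m w')
    + (1 - th) * phi i ((A i)^T *m w))%:E)%E.
Proof.
move=> z abarE w'E CE upd a'i a'j.
have [C'i C'iE leC'] := quartz_update_conjugate o i _ _ _ _ _ upd (CE i).
pose C' j := if j == i then C'i else C j.
have C'E j : conjugate (phi j) (- alpha' j) = (C' j)%:E.
  by rewrite /C'; have [->|ji] := eqVneq; rewrite ?a'i// a'j.
exists C' => //; rewrite (dual_conjugate alpha C)// (dual_conjugate alpha' C')//.
rewrite -!EFinN -EFinD lee_fin -abarE.
have sumC : \sum_(j < n) C' j = \sum_(j < n) C j + (C'i - C i).
  rewrite (bigD1 i)//= [in RHS](bigD1 i)//= {1}/C' eqxx.
  rewrite (eq_bigr C) => [|j /negPf ji]; last by rewrite /C' ji.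
  by ring.
have sumA : (lambda * N)^-1 *: (\sum_(j < n) A j *m alpha' j) =
    abar + (lambda * N)^-1 *: (A i *m Delta).
  rewrite abarE -scalerDr; congr (_ *: _).
  rewrite (bigD1 i)//= [in RHS](bigD1 i)//= a'i mulmxDr addrAC.
  by congr (_ + _ + _); apply: eq_bigr => j ji; rewrite a'j.
rewrite {}sumA {}sumC.
have sub := grad_conj_subgradient scg abar.
have /andP[_] :=
  conjugate_smooth_at scg z abar ((lambda * N)^-1 *: (A i *m Delta)) sub.
rewrite !(dotZl, dotZr).
set G := fine (conjugate g abar); set G' := fine _; set AD := dot z (A i *m Delta).
set r := (lambda * N)^-1 => leG'.
have r0 : 0 < r by rewrite invr_gt0 mulr_gt0.
have lr : lambda * r = N^-1 by rewrite /r; field; rewrite !gt_eqF.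
have {}leG' : lambda * G' <= lambda * G
    + N^-1 * (AD + v i * dot Delta Delta / (2 * lambda * N)).
  have := v_ge i Delta; rewrite -(ler_pM2l r0) -(ler_pM2l r0) => h.
  have -> : N^-1 * (AD + v i * dot Delta Delta / (2 * lambda * N)) =
      lambda * (r * AD + 1 / 2 * (r * (r * (v i * dot Delta Delta)))).
    by rewrite /r; field; rewrite !gt_eqF.
  by rewrite -mulrDr ler_pM2l//; lra.
move: leC'; rewrite -/z -/AD; set x := (A i)^T *m w'; set gx := grad _ _.
set E := C i + phi i x - _ + _ + _ => leC'.
have {}leC' : N^-1 * (C'i + AD + v i * dot Delta Delta / (2 * lambda * N))
    <= N^-1 * C i - th * E.
  have -> : N^-1 * C i - th * E = N^-1 * (C i - th * N * E).
    by field; rewrite gt_eqF.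
  by rewrite ler_pM2l ?invr_gt0.
(* As [A_i^T w - x] is [theta] times [A_i^T w - A_i^T z], this gradient inequality, weighted by
   [1 - theta], trades all inner products with [gx] for [phi_i] at the old point. *)
have := convex_grad_subgradient (phi_diff i) x (phi_convex i) ((A i)^T *m w).
have -> : (A i)^T *m w - x = - (th *: ((A i)^T *m z - (A i)^T *m w)).
  rewrite /x w'E mulmxDr -!scalemxAr.
  by apply/colP => j; rewrite !mxE; ring.
rewrite -/gx dotNr dotZr dotDr dotNr.
have : dot x gx = (1 - th) * dot gx ((A i)^T *m w) + th * dot gx ((A i)^T *m z).
  by rewrite dotC /x w'E mulmxDr dotDr -!scalemxAr !dotZr.
move: leC'; rewrite /E (_ : dot z (A i *m gx) = dot gx ((A i)^T *m z)); last first.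
  by rewrite -dot_mulmx dotC.
have th1 : 0 <= 1 - th by rewrite subr_ge0 theta_le1.
move=> h1 h2 h3; have := ler_wpM2l th1 h3.
rewrite h2 in h1; move: h1 leG'.
lra.
Qed.

(** In the average over [i] the losses at [w'] cancel against those of the primal value. Only [g w']
    remains, and convexity of [g] controls it. *)
Lemma quartz_step o alpha (alpha' : 'I_n -> 'I_n -> 'cV[R]_m) abar w w'
    (Delta : 'I_n -> 'cV[R]_m) (C : 'I_n -> R) :
  abar = (lambda * N)^-1 *: \sum_(j < n) A j *m alpha j ->
  w' = (1 - th) *: w + th *: grad_conj g abar ->
  (forall j, conjugate (phi j) (- alpha j) = (C j)%:E) ->
  (forall i, quartz_update phi g lambda gamma A p v o i (alpha i) abar w'
     (Delta i)) ->
  (forall i, alpha' i i = alpha i + Delta i) ->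
  (forall i j, j != i -> alpha' i j = alpha j) ->
  (N^-1%:E * \sum_(i < n) ((primal phi g lambda A w')%:E
                            - dual phi g lambda A (alpha' i)) <=
   (1 - th)%:E * ((primal phi g lambda A w)%:E - dual phi g lambda A alpha))%E.
Proof.
move=> abarE w'E CE upd a'i a'j; set z := grad_conj g abar in w'E.
have DE := dual_conjugate _ _ CE; set D := - _ - _ in DE.
have /choice[D' D'P] i : exists D', dual phi g lambda A (alpha' i) = D'%:E /\
    (primal phi g lambda A w' - D' <=
    primal phi g lambda A w' - D +
   (- th * (C i + dot z (A i *m alpha i)) - phi i ((A i)^T *m w')
    + (1 - th) * phi i ((A i)^T *m w))).
  have [C' C'E] := quartz_coordinate_step o i alpha (alpha' i) abar w w' (Delta i)
    C abarE w'E CE (upd i) (a'i i) (a'j i).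
  rewrite (dual_conjugate _ _ C'E) DE.
  rewrite -!EFinN -EFinD lee_fin => h.
  by eexists; split; [by []|move: h; rewrite /=; lra].
under eq_bigr do rewrite (D'P _).1 -EFinB.
rewrite sumEFin DE -EFinB -!EFinM lee_fin.
have Nv0 : 0 <= N^-1 by rewrite invr_ge0 ltW.
have := ler_wpM2l Nv0 (ler_sum (index_enum 'I_n)
  (fun i (_ : xpredT i) => (D'P i).2)).
move=> /le_trans; apply.
set PD := primal phi g lambda A w' - D.
rewrite big_split/= sumr_const card_ord -[PD *+ n]mulr_natl -/N mulrDr.
rewrite mulKf ?gt_eqF//.
rewrite !big_split/= !sumrN -!mulr_sumr big_split/=.
set S := \sum_(i < n) C i; set Z := \sum_(i < n) dot z _.
have ZE : N^-1 * Z = lambda * (fine (conjugate g abar) + g z).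
  have sub := grad_conj_subgradient scg abar.
  rewrite (conjugate_subgradient _ _ _ sub)/= -/z subrK abarE dotZr dot_sumr.
  by rewrite -/Z; field; rewrite !gt_eqF.
have gw' : g w' <= (1 - th) * g w + th * g z.
  have th1 : 0 <= 1 - th by rewrite subr_ge0 theta_le1.
  have := convex_functionW g scg.1 (1 - th) w z th1.
  by rewrite subKr -w'E; apply; rewrite gerBl theta_ge0.
have {}gw' := ler_wpM2l (ltW lambda_gt0) gw'.
have thZ := congr1 ( *%R th) ZE.
rewrite /PD /D /primal -/N -/S -abarE.
lra.
Qed.

(** This makes a run a function of its draws. By strong convexity of the conjugate, the midpoint of
    two Option I maximizers would gain at least [gamma |Delta2 - Delta1|^2 / 8]. *)
Lemma quartz_update_unique o i a abar w Delta1 Delta2 :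
  quartz_update phi g lambda gamma A p v o i a abar w Delta1 ->
  quartz_update phi g lambda gamma A p v o i a abar w Delta2 ->
  Delta1 = Delta2.
Proof.
case: o => /= [max1 max2|-> ->//].
have [c0 c0E] : exists c0, conjugate (phi i) (grad (phi i) 0) = c0%:E.
  by eexists; exact/conjugate_subgradient/convex_grad_subgradient.
have fin_max Delta : (forall Delta' : 'cV_m,
    (optionI_objective phi g lambda A v i a abar Delta' <=
     optionI_objective phi g lambda A v i a abar Delta)%E) ->
    exists C, conjugate (phi i) (- (a + Delta)) = C%:E.
  (* For this competitor the conjugate is taken at [grad phi_i 0], where it is finite; hence a
     maximizer has a finite value. *)
  move=> /(_ (- (a + grad (phi i) 0))); rewrite /optionI_objective.
  have -> : - (a + - (a + grad (phi i) 0)) = grad (phi i) 0.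
    by rewrite opprD opprK addKr.
  rewrite c0E; have := conjugate_gtNy (phi i) (- (a + Delta)).
  by case: (conjugate (phi i) (- (a + Delta))) => // C _ _; exists C.
have [C1 C1E] := fin_max _ max1; have [C2 C2E] := fin_max _ max2.
pose Dm := (1 - 2^-1) *: Delta1 + 2^-1 *: Delta2.
have half0 : 0 <= (2^-1 : R) by [].
have half1 : (2^-1 : R) <= 1 by lra.
have := conjugate_strongly_convex (phi i) gamma 2^-1 C1 C2 (- (a + Delta1))
  (- (a + Delta2)) (phi_diff i) gamma_gt0 (phi_lip i) half0 half1.
rewrite C1E C2E => /(_ (lexx _) (lexx _)).
have -> : (1 - 2^-1) *: - (a + Delta1) + 2^-1 *: - (a + Delta2) = - (a + Dm).
  by apply/colP => j; rewrite /Dm !mxE; field.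
have -> : - (a + Delta1) - (- (a + Delta2)) = Delta2 - Delta1.
  by apply/colP => j; rewrite !mxE; ring.
move: (max1 Delta2) (max2 Dm); rewrite /optionI_objective !enorm_sqr C1E C2E.
have := conjugate_gtNy (phi i) (- (a + Dm)).
case: (conjugate (phi i) (- (a + Dm))) => // Cm _.
rewrite -!EFinN -!EFinB !lee_fin => h1 h2 h3.
have qm : dot Dm Dm = 2^-1 * dot Delta1 Delta1 + 2^-1 * dot Delta2 Delta2
    - 4^-1 * dot (Delta2 - Delta1) (Delta2 - Delta1).
  rewrite /Dm !(dotDl, dotDr, dotNl, dotNr, dotZl, dotZr) (dotC Delta2 Delta1).
  by field.
have q0 := dot_ge0 (Delta2 - Delta1).
have lm : dot (grad_conj g abar) (A i *m Dm) =
    2^-1 * dot (grad_conj g abar) (A i *m Delta1)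
    + 2^-1 * dot (grad_conj g abar) (A i *m Delta2).
  by rewrite /Dm mulmxDr -!scalemxAr dotDr !dotZr; field.
have r0 : 0 <= v i / (2 * lambda * N) by rewrite divr_ge0// ltW// !mulr_gt0.
have rE x : v i * x / (2 * lambda * N) = v i / (2 * lambda * N) * x.
  by rewrite mulrAC.
move: h1 h2; rewrite lm !rE qm => h1 h2.
have rq := mulr_ge0 r0 q0.
have gq : 0 <= gamma * dot (Delta2 - Delta1) (Delta2 - Delta1).
  by rewrite mulr_ge0 // ltW.
have : gamma * dot (Delta2 - Delta1) (Delta2 - Delta1) <= 0.
  by move: h1 h2 h3 rq; rewrite -/N; lra.
rewrite pmulr_rle0// => qle; apply/esym/eqP; rewrite -subr_eq0; apply/eqP.
by apply: dot_eq0; apply/eqP; rewrite eq_le qle.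
Qed.

End one_step.

(** * Determinism of a run given its draws *)

Section run.
Context {R : realType} {n d m : nat}.
Variables (phi : 'I_n -> 'cV[R]_m -> R) (g : 'cV[R]_d -> R) (lambda gamma : R).
Variables (A : 'I_n -> 'M[R]_(d, m)) (p v : 'I_n -> R).
Variables (o : quartz_option) (w0 : 'cV[R]_d) (alpha0 : 'I_n -> 'cV[R]_m).

Lemma quartz_run_abar draw w abar alpha dalpha :
  quartz_run phi g lambda gamma A p v o w0 alpha0 draw w abar alpha dalpha ->
  forall t, abar t = (lambda * n%:R)^-1 *: \sum_(i < n) A i *m alpha t i.
Proof.
move=> [_ a0 ab0 _ anotin ain _ abS]; elim=> [|t IH]; first by rewrite a0.
rewrite abS IH -scalerDr; congr (_ *: _).
rewrite [X in _ + X]big_mkcond -big_split/=; apply: eq_bigr => i _.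
by case: ifPn => it; [rewrite ain// mulmxDr|rewrite anotin// addr0].
Qed.

Hypothesis update_unique : forall i a abar w Delta1 Delta2,
  quartz_update phi g lambda gamma A p v o i a abar w Delta1 ->
  quartz_update phi g lambda gamma A p v o i a abar w Delta2 ->
  Delta1 = Delta2.

Lemma quartz_run_unique draw1 w1 abar1 alpha1 dalpha1 draw2 w2 abar2 alpha2
    dalpha2 :
  quartz_run phi g lambda gamma A p v o w0 alpha0 draw1 w1 abar1 alpha1 dalpha1 ->
  quartz_run phi g lambda gamma A p v o w0 alpha0 draw2 w2 abar2 alpha2 dalpha2 ->
  forall t, (forall s, (s < t)%N -> draw1 s.+1 = draw2 s.+1) ->
  w1 t = w2 t /\ alpha1 t = alpha2 t.
Proof.
move=> r1 r2; elim=> [_|t IH same].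
  by rewrite (quartz_w0 r1) (quartz_w0 r2) (quartz_alpha0 r1) (quartz_alpha0 r2).
have [wt at_] := IH (fun s st => same s (ltnW st)).
have abt : abar1 t = abar2 t.
  by rewrite (quartz_run_abar _ _ _ _ _ r1) (quartz_run_abar _ _ _ _ _ r2) at_.
have wS : w1 t.+1 = w2 t.+1 by rewrite (quartz_w r1) (quartz_w r2) wt abt.
split=> //; apply/funext => i; have St := same t (leqnn _).
have [it|it] := boolP (i \in draw1 t.+1); last first.
  by rewrite (quartz_notin r1)// (quartz_notin r2) -?St// at_.
have it2 : i \in draw2 t.+1 by rewrite -St.
rewrite (quartz_in r1)// (quartz_in r2)// at_; congr (_ + _).
have := quartz_dalpha r2 it2; rewrite -at_ -abt -wS.
exact: update_unique (quartz_dalpha r1 it).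
Qed.

End run.

(** * Serial sampling *)

Section serial_sampling.
Context {R : realType} {n : nat} {dO : measure_display}
  {Omega : measurableType dO} (Pr : probability Omega R).
Implicit Types X : {RV Pr >-> {set 'I_n}}.

Lemma measurable_draw X (B : set {set 'I_n}) : measurable (X @^-1` B).
Proof. exact: measurable_funPTI. Qed.

Lemma prob_preimage X (P : pred {set 'I_n}) :
  Pr (X @^-1` [set` P]) = (\sum_(S | P S) Pr (X @^-1` [set S]))%E.
Proof.
have -> : X @^-1` [set` P] = \bigcup_(S in [set` P]) X @^-1` [set S].
  by apply/seteqP; split => [om /= ?|om /= [S PS ->]//]; exists (X om).
rewrite measure_fin_bigcup.
- rewrite [RHS](bigfs _ (r := index_enum _))//; first exact: index_enum_uniq.
  by move=> S _; rewrite mem_index_enum.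
- exact: finite_finset.
- by move=> S T _ _ [om [/= -> ->]].
- by move=> S _; exact: measurable_draw.
Qed.

Hypothesis n_gt0 : (0 < n)%N.

Lemma sum_singletons {V : nmodType} (F : {set 'I_n} -> V) :
  (forall S, (forall i, S != [set i]%SET) -> F S = 0) ->
  \sum_S F S = \sum_i F [set i]%SET.
Proof.
move=> F0; rewrite (bigID (mem [set [set i]%SET | i : 'I_n]%SET))/=.
rewrite [X in _ + X]big1 ?addr0 => [|S /imsetP SN]; last first.
  by apply: F0 => i; apply/eqP => Si; apply: SN; exists i.
by rewrite big_imset// => i j _ _; exact: set1_inj.
Qed.

Lemma sum_prob_singletons X :
  (forall i, Pr (X @^-1` [set [set i]%SET]) = (n%:R^-1)%:E) ->
  (\sum_(i < n) Pr (X @^-1` [set [set i]%SET]) = 1)%E.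
Proof.
move=> Xi; rewrite (eq_bigr _ (fun i _ => Xi i)) sumEFin sumr_const card_ord.
by rewrite -[n%:R^-1 *+ n]mulr_natl mulfV// pnatr_eq0 -lt0n.
Qed.

(** The [n] singletons already carry the total mass 1, so there is none left for another set. *)
Lemma serial_nonsingleton X S :
  (forall i, Pr (X @^-1` [set [set i]%SET]) = (n%:R^-1)%:E) ->
  (forall i, S != [set i]%SET) -> Pr (X @^-1` [set S]) = 0%E.
Proof.
move=> Xi SN; pose I := [set [set i]%SET | i : 'I_n]%SET.
have SI : S \notin I by apply/imsetP => -[i _ Si]; move: (SN i); rewrite Si eqxx.
have := prob_preimage X (mem (S |: I)%SET).
rewrite big_setU1//= big_imset/=; last by move=> i j _ _; exact: set1_inj.
rewrite (eq_bigl xpredT) ?sum_prob_singletons// => h.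
apply/eqP; rewrite eq_le measure_ge0 andbT.
have : (Pr (X @^-1` [set` mem (S |: I)%SET]) <= 1)%E.
  exact/probability_le1/measurable_draw.
by rewrite h -{2}(add0e 1%E) leeD2rE.
Qed.

Lemma serial_inclusion_prob X :
  (forall i, Pr (X @^-1` [set [set i]%SET]) = (n%:R^-1)%:E) ->
  forall i, inclusion_prob Pr X i = n%:R^-1.
Proof.
move=> Xi i; rewrite /inclusion_prob.
have -> : [set om | i \in X om] = X @^-1` [set` [pred S : {set 'I_n} | i \in S]].
  by [].
rewrite prob_preimage big_mkcond/= (sum_singletons (fun S =>
  if i \in S then Pr (X @^-1` [set S]) else 0%E)) => [|S SN]; last first.
  by case: ifP => // _; exact: serial_nonsingleton.
rewrite (bigD1 i)//= big1 => [|j ji]; last by rewrite inE eq_sym (negPf ji).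
by rewrite addr0 inE eqxx Xi.
Qed.

Variable draw : nat -> {RV Pr >-> {set 'I_n}}.
Hypothesis draw_singleton : forall t i,
  Pr (draw t.+1 @^-1` [set [set i]%SET]) = (n%:R^-1)%:E.
Hypothesis draw_indep : mutually_independent Pr
  (fun t : nat => draw t.+1 : Omega -> {set 'I_n}).

(** The cylinder event of a draw prefix. Position [t] of [l] holds draw [t.+1]; the default of [nth]
    is never reached. *)
Definition drawn (l : seq {set 'I_n}) : set Omega :=
  [set om | forall t, (t < size l)%N -> draw t.+1 om = nth finset.set0 l t].

Lemma drawnE l : drawn l = \bigcap_(t in [set` iota 0 (size l)])
  draw t.+1 @^-1` [set nth finset.set0 l t].
Proof.
apply/seteqP; split=> [om h t /=|om h t tl].
  by rewrite mem_iota => /andP[_ tl]; exact: h.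
by apply: (h t); rewrite /= mem_iota.
Qed.

Lemma measurable_drawn l : measurable (drawn l).
Proof.
by rewrite drawnE; apply: bigcap_measurableType => t _; exact: measurable_draw.
Qed.

Lemma drawn_rcons l S :
  drawn (rcons l S) = drawn l `&` draw (size l).+1 @^-1` [set S].
Proof.
apply/seteqP; split=> [om h|om [h hS] t].
  split=> [t tl|]; last first.
    by rewrite /= h ?size_rcons// nth_rcons ltnn eqxx.
  by rewrite h ?size_rcons ?ltnS 1?ltnW// nth_rcons tl.
rewrite size_rcons ltnS leq_eqVlt nth_rcons => /orP[/eqP ->|tl].
  by rewrite ltnn eqxx.
by rewrite tl h.
Qed.

Lemma prob_drawn_singletons (l : seq 'I_n) :
  Pr (drawn [seq [set i]%SET | i <- l]) = (n%:R^-1 ^+ size l)%:E.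
Proof.
rewrite drawnE draw_indep ?iota_uniq// size_map.
rewrite (eq_big_seq (fun=> (n%:R^-1 : R)%:E)) => [|t]; last first.
  rewrite mem_iota => /andP[_ tl].
  by rewrite (nth_map (Ordinal n_gt0))// draw_singleton.
rewrite big_const_seq count_predT size_iota.
by elim: (size l) => //= k ->; rewrite -EFinM -exprS.
Qed.

Lemma prob_drawn_rcons_nonsingleton l S :
  (forall i, S != [set i]%SET) -> Pr (drawn (rcons l S)) = 0%E.
Proof.
move=> SN; rewrite drawn_rcons.
apply: (@subset_measure0 _ _ _ _ _ (draw (size l).+1 @^-1` [set S])).
- by apply: measurableI; [exact: measurable_drawn|exact: measurable_draw].
- exact: measurable_draw.
- exact: subIsetr.
- exact: serial_nonsingleton.
Qed.

(** * Contraction in expectation along draw prefixes *)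

Variables (F : nat -> Omega -> \bar R) (c : R).
Hypothesis c_ge0 : 0 <= c.
Hypothesis F_ge0 : forall t om, (0 <= F t om)%E.
Hypothesis F_adapted : forall t om om',
  (forall s, (s < t)%N -> draw s.+1 om = draw s.+1 om') -> F t om = F t om'.
Hypothesis F_step : forall t om (om' : 'I_n -> Omega),
  (forall s, (s < t)%N -> exists i, draw s.+1 om = [set i]%SET) ->
  (forall i s, (s < t)%N -> draw s.+1 (om' i) = draw s.+1 om) ->
  (forall i, draw t.+1 (om' i) = [set i]%SET) ->
  ((n%:R^-1)%:E * \sum_i F t.+1 (om' i) <= c%:E * F t om)%E.

Lemma drawn_eq l om om' : drawn l om -> drawn l om' ->
  F (size l) om = F (size l) om'.
Proof. by move=> h h'; apply: F_adapted => s sl; rewrite h ?h'. Qed.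

(** [F T] is constant on each of the finitely many cylinders of length [T]. For the gap this is the
    only source of measurability, the iterates being arbitrary functions of the outcome. *)
Lemma measurable_adapted T : measurable_fun setT (F T).
Proof.
move=> _ Y mY; rewrite setTI.
have -> : F T @^-1` Y = \bigcup_(l in [set l : T.-tuple {set 'I_n} |
    exists2 om, drawn l om & Y (F T om)]) drawn l.
  apply/seteqP; split => [om Yom|om [l [om' dom' Yom'] dom]].
    pose l := [tuple (draw (val t).+1 om) | t < T].
    have dl : drawn l om.
      move=> t; rewrite size_tuple => tT.
      by rewrite -[t]/(val (Ordinal tT)) -tnth_nth tnth_mktuple.
    by exists l => //; exists om.
  by have := drawn_eq _ _ _ dom dom'; rewrite size_tuple /= => ->.
apply: fin_bigcup_measurable => [|l _]; first exact: finite_finset.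
exact: measurable_drawn.
Qed.

(** Induction on the number [k] of draws still to come: a cylinder splits by its next draw,
    nonsingleton pieces are null, and [F_step] bounds the average over the [n] others. *)
Lemma integral_drawn_le T k (l : seq 'I_n) om : (size l + k = T)%N ->
  drawn [seq [set i]%SET | i <- l] om ->
  (\int[Pr]_(x in drawn [seq [set i]%SET | i <- l]) F T x <=
   (n%:R^-1 ^+ size l * c ^+ k)%:E * F (size l) om)%E.
Proof.
elim: k l om => [|k IH] l om.
  rewrite addn0 => <- dom; rewrite expr0 mulr1.
  have Fc : {in drawn [seq [set i]%SET | i <- l],
      F (size l) =1 cst (F (size l) om)}.
    by move=> x /set_mem dx; have := drawn_eq _ _ _ dx dom; rewrite size_map.
  rewrite (eq_integral _ _ Fc) integral_cst; last exact: measurable_drawn.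
  by rewrite muleC -prob_drawn_singletons.
set L := [seq [set i]%SET | i <- l] => lT dom.
have sL : size L = size l by rewrite size_map.
have -> : drawn L = \big[setU/set0]_(S <- index_enum {set 'I_n}) drawn (rcons L S).
  rewrite -bigcup_seq; apply/seteqP; split => [x dx|x [S _]].
    exists (draw (size L).+1 x); first by rewrite /= mem_index_enum.
    by rewrite drawn_rcons.
  by rewrite drawn_rcons => -[].
rewrite ge0_integral_bigsetU//; last 4 first.
- by move=> S; exact: measurable_drawn.
- exact: index_enum_uniq.
- by move=> S S' _ _ [x []]; rewrite !drawn_rcons => -[_ /= ->] [_ /= ->].
- exact/measurable_funTS/measurable_adapted.
rewrite sum_singletons => [|S SN]; last first.
  apply: null_set_integral; first exact: measurable_drawn.
    exact/measurable_funTS/measurable_adapted.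
  exact: prob_drawn_rcons_nonsingleton.
(* Each extended cylinder has positive probability, so it contains a representative outcome. *)
have /choice[om' dom'] i : exists x, drawn [seq [set i]%SET | i <- rcons l i] x.
  apply/set0P/eqP => d0; have := prob_drawn_singletons (rcons l i).
  rewrite d0 measure0 => /eqP; rewrite eqe eq_sym expf_eq0 invr_eq0 pnatr_eq0.
  by rewrite (gtn_eqF n_gt0) andbF.
have le1 : (\sum_i \int[Pr]_(x in drawn (rcons L [set i]%SET)) F T x <=
  \sum_i (n%:R^-1 ^+ (size l).+1 * c ^+ k)%:E * F (size l).+1 (om' i))%E.
  apply: lee_sum => i _; rewrite -map_rcons -(size_rcons l i).
  by apply: IH => //; rewrite size_rcons addSnnS.
apply: le_trans le1 _.
rewrite -ge0_sume_distrr => [|i _]; last exact: F_ge0.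
rewrite exprS -mulrA mulrC EFinM -muleA exprSr mulrA [in leRHS]EFinM -muleA.
apply: lee_wpmul2l; first by rewrite lee_fin mulr_ge0// exprn_ge0// invr_ge0.
have dL i s : (s < size l)%N -> draw s.+1 (om' i) = nth finset.set0 L s.
  move=> sl; rewrite dom' ?size_map ?size_rcons 1?ltnW//.
  by rewrite map_rcons nth_rcons size_map sl.
apply: F_step => [s sl|i s sl|i].
- exists (nth (Ordinal n_gt0) l s).
  by rewrite dom ?sL// (nth_map (Ordinal n_gt0)).
- by rewrite dL// dom ?sL.
- by rewrite dom' ?size_map ?size_rcons// map_rcons nth_rcons size_map ltnn eqxx.
Qed.

Lemma integral_contraction T om :
  (\int[Pr]_x F T x <= (c ^+ T)%:E * F 0%N om)%E.
Proof.
have d0 : drawn [::] = setT by apply/seteqP; split.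
have := integral_drawn_le T T [::] om (add0n T).
by rewrite /= d0 mul1r; apply.
Qed.

End serial_sampling.

(** * The iteration bound *)

Lemma geometric_decay_le {R : realType} (th K G eps : R) (T : nat) :
  0 <= th -> th <= 1 -> 0 < K -> K^-1 <= th -> 0 < eps -> 0 < G ->
  K * ln (G / eps) <= T%:R -> (1 - th) ^+ T * G <= eps.
Proof.
move=> th0 th1 K0 Kth e0 G0 hT.
have lnT : ln (G / eps) <= th * T%:R.
  apply: (@le_trans _ _ (K^-1 * T%:R)); first by rewrite ler_pdivlMl.
  by rewrite ler_wpM2r.
have : (1 - th) ^+ T <= expR (- ln (G / eps)).
  apply: (@le_trans _ _ (expR (- th) ^+ T)).
    rewrite lerXn2r ?nnegrE ?expR_ge0 ?subr_ge0//.
    exact: expR_ge1Dx.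
  by rewrite -expRM_natr ler_expR mulNr lerN2.
rewrite expRN lnK ?posrE ?divr_gt0// invf_div => /(ler_wpM2r (ltW G0)).
by rewrite divfK ?gt_eqF.
Qed.

Theorem corollary10 (R : realType) (n d m : nat)
    (phi : 'I_n -> 'cV[R]_m -> R) (g : 'cV[R]_d -> R) (lambda gamma : R)
    (A : 'I_n -> 'M[R]_(d, m)) (v : 'I_n -> R)
    (hn : (0 < n)%N)
    (hgamma : 0 < gamma)
    (hlambda : 0 < lambda)
    (hphi_convex : forall i,
       convex_function [set: convex_lmodType 'cV[R]_m] (phi i))
    (hphi_diff : forall i x, differentiable (phi i) x)
    (hphi_lip : forall i, lipschitz_grad gamma^-1 (phi i))
    (hg : strongly_convex 1 g)
    (hA : forall i, A i != 0)
    (hv : forall i, v i = lambda_max ((A i)^T *m A i))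
    (dO : measure_display) (Omega : measurableType dO)
    (Pr : probability Omega R)
    (Shat : {RV Pr >-> {set 'I_n}})
    (hserial : forall i, Pr (Shat @^-1` [set [set i]%SET]) = (n%:R^-1)%:E)
    (draw : nat -> {RV Pr >-> {set 'I_n}})
    (hdraw_law : forall t (B : set {set 'I_n}),
       distribution Pr (draw t.+1) B = distribution Pr Shat B)
    (hdraw_indep : mutually_independent Pr
       (fun t : nat => draw t.+1 : Omega -> {set 'I_n}))
    (o : quartz_option) (w0 : 'cV[R]_d) (alpha0 : 'I_n -> 'cV[R]_m)
    (w abar : nat -> Omega -> 'cV[R]_d)
    (alpha dalpha : nat -> Omega -> 'I_n -> 'cV[R]_m)
    (hrun : forall om,
       quartz_run phi g lambda gamma A (inclusion_prob Pr Shat) v o w0 alpha0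
         (fun t => draw t om) (fun t => w t om) (fun t => abar t om)
         (fun t => alpha t om) (fun t => dalpha t om))
    (eps : R) (heps : 0 < eps)
    (heps_le : (eps%:E <= (primal phi g lambda A w0)%:E
                          - dual phi g lambda A alpha0)%E)
    (T : nat)
    (hT : ((n%:R + sup (range (fun i => lambda_max ((A i)^T *m A i)))
                     / (lambda * gamma))%:E
           * lne (((primal phi g lambda A w0)%:E - dual phi g lambda A alpha0)
                  * (eps^-1)%:E)
           <= (T%:R)%:E)%E) :
  (\int[Pr]_om ((primal phi g lambda A (w T om))%:E
                - dual phi g lambda A (alpha T om)) <= eps%:E)%E.
Proof.
have Pdraw t i : Pr (draw t.+1 @^-1` [set [set i]%SET]) = (n%:R^-1)%:E.
  by rewrite -(hserial i); exact: hdraw_law.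
(* A nonzero [A_i] forces [m > 0], so that there is a unit vector over which to maximize the
   Rayleigh quotient. *)
have m0 (i : 'I_n) : (0 < m)%N.
  rewrite lt0n; apply/eqP => m0; have := hA i.
  by move: (A i); rewrite m0 => B; rewrite thinmx0 eqxx.
have v_ge i x : dot (A i *m x) (A i *m x) <= v i * dot x x.
  by rewrite hv; exact: lambda_max_gram (m0 i).
have v_ge0 i : 0 <= v i.
  have := v_ge i (delta_mx (Ordinal (m0 i)) 0).
  rewrite dot_delta mxE !eqxx mulr1; exact/le_trans/dot_ge0.
set p := inclusion_prob Pr Shat in hrun.
have pE i : p i = n%:R^-1 by exact: serial_inclusion_prob.
set th := theta lambda gamma p v.
have th0 : 0 <= th by exact: theta_ge0.
have th1 : th <= 1 by exact: theta_le1.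
have upd_unique := quartz_update_unique phi g lambda gamma A p v hn hgamma
  hlambda hphi_convex hphi_diff hphi_lip v_ge0 o.
pose F t om : \bar R :=
  ((primal phi g lambda A (w t om))%:E - dual phi g lambda A (alpha t om))%E.
have F_ge0 t om : (0 <= F t om)%E.
  by rewrite sube_ge0 ?orbT//; exact: dual_le_primal.
have same t om om' : (forall s, (s < t)%N -> draw s.+1 om = draw s.+1 om') ->
    w t om = w t om' /\ alpha t om = alpha t om'.
  exact: (quartz_run_unique _ _ _ _ _ _ _ _ _ _ upd_unique _ _ _ _ _ _ _ _ _ _
    (hrun om) (hrun om')).
have abarE om t : abar t om = (lambda * n%:R)^-1 *: \sum_(i < n) A i *m alpha t om i.
  exact: (quartz_run_abar _ _ _ _ _ _ _ _ _ _ _ _ _ _ _ (hrun om)).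
set V := sup _ in hT; have vV i : v i <= V.
  rewrite hv; apply: ub_le_sup; last by exists i.
  exists (\sum_j v j) => _ [j _ <-].
  by rewrite -hv (bigD1 j)//= lerDl sumr_ge0.
set K := n%:R + V / _ in hT.
have K0 : 0 < K.
  rewrite ltr_wpDr ?ltr0n// divr_ge0//; last by rewrite ltW// mulr_gt0.
  exact: le_trans (v_ge0 (Ordinal hn)) (vV _).
have Kth : K^-1 <= th by exact: theta_ge.
set P0 := primal phi g lambda A w0 in heps_le hT.
have D0P0 : (dual phi g lambda A alpha0 <= P0%:E)%E by exact: dual_le_primal.
(* The value [-oo] would make the initial gap, its logarithm and, as [K > 0], the left side of [hT]
   infinite; weak duality excludes [+oo]. *)
case D0E : (dual phi g lambda A alpha0) heps_le hT D0P0 => [D0| |]//; last first.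
  move=> _ + _; rewrite gt0_mulye ?lte_fin ?invr_gt0//=.
  by rewrite gt0_muley ?lte_fin.
rewrite -EFinB -EFinM lee_fin => heps_le hT _.
have G0 : 0 < P0 - D0 := lt_le_trans heps heps_le.
rewrite lne_EFin ?divr_gt0// -EFinM lee_fin in hT.
(* No conjugate is [-oo], so a single [+oo] would make the sum infinite and the initial dual value
   [-oo]. *)
have fin0 i : exists c, conjugate (phi i) (- alpha0 i) = c%:E.
  case Ci : (conjugate (phi i) (- alpha0 i)) => [c| |]; first by exists c.
    have sumy : (\sum_(j < n) conjugate (phi j) (- alpha0 j) = +oo)%E.
      apply/eqP; rewrite esum_eqy; first by apply/existsP; exists i; rewrite Ci.
      by move=> j _; rewrite gt_eqF// conjugate_gtNy.
    move: D0E; rewrite /dual sumy gt0_muley ?lte_fin ?invr_gt0 ?ltr0n//.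
    by rewrite -(conjugate_fin hg).
  by have := conjugate_gtNy (phi i) (- alpha0 i); rewrite Ci.
(* Finiteness spreads from [alpha0] along singleton draws; the one-step bound asks for it. *)
have fin t om : (forall s, (s < t)%N -> exists i, draw s.+1 om = [set i]%SET) ->
    exists C, forall i, conjugate (phi i) (- alpha t om i) = (C i)%:E.
  elim: t => [_|t IH single].
    by have /choice[C CE] := fin0; exists C; rewrite (quartz_alpha0 (hrun om)).
  have [C CE] := IH (fun s st => single s (ltnW st)).
  have [i dE] := single t (leqnn _).
  have it : i \in draw t.+1 om by rewrite dE inE.
  have [||||||C' C'E _] := quartz_coordinate_step phi g lambda gamma A p v hn hgamma
    hlambda hphi_convex hphi_diff hphi_lip hg pE v_ge0 v_ge o i (alpha t om)
    (alpha t.+1 om) (abar t om) (w t om) (w t.+1 om) (dalpha t.+1 om i) C.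
  - exact: abarE.
  - exact: quartz_w (hrun om) t.
  - exact: CE.
  - by have := quartz_dalpha (hrun om) it.
  - by have := quartz_in (hrun om) it.
  - move=> j ji; have jt : j \notin draw t.+1 om by rewrite dE inE.
    by have := quartz_notin (hrun om) jt.
  - by exists C'.
have F_step t om (om' : 'I_n -> Omega) :
    (forall s, (s < t)%N -> exists i, draw s.+1 om = [set i]%SET) ->
    (forall i s, (s < t)%N -> draw s.+1 (om' i) = draw s.+1 om) ->
    (forall i, draw t.+1 (om' i) = [set i]%SET) ->
    ((n%:R^-1)%:E * \sum_i F t.+1 (om' i) <= (1 - th)%:E * F t om)%E.
  move=> single agree new; have [C CE] := fin t om single.
  have wt i : w t (om' i) = w t om := (same t _ _ (agree i)).1.
  have at_ i : alpha t (om' i) = alpha t om := (same t _ _ (agree i)).2.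
  have abt i : abar t (om' i) = abar t om by rewrite !abarE at_.
  (* The next primal point is computed before the draw, hence is common to all [om' i]. *)
  pose w' := (1 - th) *: w t om + th *: grad_conj g (abar t om).
  have w'E i : w t.+1 (om' i) = w'.
    by rewrite (quartz_w (hrun (om' i))) wt abt.
  have it i : i \in draw t.+1 (om' i) by rewrite new inE.
  under eq_bigr do rewrite /F w'E.
  apply: (quartz_step _ _ _ _ _ _ _ hn hgamma hlambda hphi_convex hphi_diff
    hphi_lip hg pE v_ge0 v_ge o (alpha t om) (fun i => alpha t.+1 (om' i))
    (abar t om) (w t om) w' (fun i => dalpha t.+1 (om' i) i) C) => //.
  - move=> i; rewrite -(w'E i) -{1}(at_ i) -(abt i).
    by have := quartz_dalpha (hrun (om' i)) (it i).
  - by move=> i; rewrite -(at_ i); have := quartz_in (hrun (om' i)) (it i).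
  - move=> i j ji; have jt : j \notin draw t.+1 (om' i) by rewrite new inE.
    by rewrite -(at_ i); have := quartz_notin (hrun (om' i)) jt.
(* A probability space has an outcome; at time 0 every outcome carries the same deterministic
   state. *)
have [om _] : [set: Omega] !=set0.
  apply/set0P/eqP => O0; have := probability_setT Pr.
  by rewrite O0 measure0 => /eqP; rewrite eqe eq_sym oner_eq0.
have F_adapted t om1 om2 : (forall s, (s < t)%N -> draw s.+1 om1 = draw s.+1 om2) ->
    F t om1 = F t om2.
  by move=> /same[wE aE]; rewrite /F wE aE.
apply: le_trans (integral_contraction Pr hn draw Pdraw hdraw_indep F (1 - th) _
  F_ge0 F_adapted F_step T om) _; first by rewrite subr_ge0.
rewrite /F (quartz_w0 (hrun om)) (quartz_alpha0 (hrun om)) D0E -EFinB -EFinM.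
by rewrite lee_fin; exact: geometric_decay_le hT.
Qed.
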